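(* Let $\mathcal{A}$ be a smooth proper triangulated category which is Calabi-Yau of dimension $3$. Let $\mathrm{rank}_1, \mathrm{rank}_2$ be non-trivial rank functions on $\mathcal{A}$ and, for $i=1,2$, let $\mathfrak{T}_{\mathcal{A},i}^{\bullet}$ be a homological unit for $\mathcal{A}$ with respect to $\mathrm{rank}_i$. Let $\mathrm{cl}$ denote the class map $\mathcal{A}\to\mathrm{K}_0(\mathcal{A})$ (and also its composition with $\mathrm{K}_0(\mathcal{A})\to\mathrm{K}_{num}(\mathcal{A})$), and let $\mathcal{A}_{unitary}^{(i)}$ be the set of objects of $\mathcal{A}$ which are unitary with respect to $\mathfrak{T}_{\mathcal{A},i}^{\bullet}$. For $p,q\in\{0,\ldots,3\}$ let $h_i^{p,q}(\mathcal{A})$ be the Hodge numbers of $\mathcal{A}$ associated to $\mathfrak{T}_{\mathcal{A},i}^{\bullet}$. 1. (a) If both $\mathrm{cl}(\mathcal{A}_{unitary}^{(1)})$ and $\mathrm{cl}(\mathcal{A}_{unitary}^{(2)})$ generate $\mathrm{K}_0(\mathcal{A})\otimes\mathbb{C}$, then $h_1^{p,q}(\mathcal{A})=h_2^{p,q}(\mathcal{A})$ for all $p,q\in\{0,\ldots,3\}$. (b) If $\mathfrak{T}_{\mathcal{A},1}^{\bullet}=\mathbb{C}\oplus\mathbb{C}[3]$, $\mathrm{cl}(\mathcal{A}_{unitary}^{(1)})$ generates $\mathrm{K}_0(\mathcal{A})\otimes\mathbb{C}$, and there exists a unitary object in $\mathcal{A}$ with respect to $\mathfrak{T}_{\mathcal{A},2}^{\bullet}$,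 then $h_1^{p,q}(\mathcal{A})=h_2^{p,q}(\mathcal{A})$ for all $p,q\in\{0,\ldots,3\}$. 2. If $\mathrm{rank}_1$ and $\mathrm{rank}_2$ are numerical rank functions on $\mathcal{A}$, then the same conclusions hold when, in (a), one only assumes that $\mathrm{cl}(\mathcal{A}_{unitary}^{(1)})$ and $\mathrm{cl}(\mathcal{A}_{unitary}^{(2)})$ generate $\mathrm{K}_{num}(\mathcal{A})\otimes\mathbb{C}$, and, in (b), one only assumes that $\mathrm{cl}(\mathcal{A}_{unitary}^{(1)})$ generates $\mathrm{K}_{num}(\mathcal{A})\otimes\mathbb{C}$ (the other hypotheses being unchanged).
   Context: Conventions: all triangulated categories are $\mathbb{C}$-linear and proper, i.e. realizable as derived categories of DG-modules over a proper DG-algebra; ''smooth'' means realizable as a derived category of DG-modules over a smooth DG-algebra. $\mathcal{A}$ is Calabi-Yau of dimension $p$ if the shift $[p]$ is a Serre functor for $\mathcal{A}$. Write $\mathrm{Hom}^{\bullet}_{\mathcal{A}}(\mathcal{E},\mathcal{F}) = \bigoplus_k \mathrm{Hom}_{\mathcal{A}}(\mathcal{E},\mathcal{F}[k])$. Rank function: a function $\mathrm{rk}:\mathcal{A}\to\mathbb{Z}$ additive with respect to exact triangles and with $\mathrm{rk}(\mathcal{F}[1])=-\mathrm{rk}(\mathcal{F})$ for all $\mathcal{F}$. It is trivial if it is the zero function. It is numerical if it descends to a map $\mathrm{K}_{num}(\mathcal{A})\to\mathbb{Z}$, where $\mathrm{K}_{num}(\mathcal{A})$ is the quotient of $\mathrm{K}_0(\mathcal{A})$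 by the kernel of the bilinear form $\chi(\mathcal{E},\mathcal{F})=\sum_{k \in \mathbb{Z}}(-1)^k\dim \mathrm{Ext}^k(\mathcal{E},\mathcal{F})$. Homological unit: let $\mathcal{A}$ carry a non-trivial rank function $\mathrm{rank}$. A graded algebra $\mathfrak{T}_{\mathcal{A}}^{\bullet}$ is a homological unit for $\mathcal{A}$ (with respect to $\mathrm{rank}$) if it is maximal (with respect to embeddings of graded algebras) for the following property: for every object $\mathcal{F}\in\mathcal{A}$ there is a pair of morphisms $i_{\mathcal{F}}:\mathfrak{T}_{\mathcal{A}}^{\bullet}\to\mathrm{Hom}^{\bullet}_{\mathcal{A}}(\mathcal{F},\mathcal{F})$ and $t_{\mathcal{F}}:\mathrm{Hom}^{\bullet}_{\mathcal{A}}(\mathcal{F},\mathcal{F})\to\mathfrak{T}_{\mathcal{A}}^{\bullet}$ such that (i) $i_{\mathcal{F}}$ is a graded algebra morphism, functorial in the sense that for all $\mathcal{F},\mathcal{G}\in\mathcal{A}$, $a\in\mathfrak{T}_{\mathcal{A}}^{k}$ and $\psi:\mathcal{F}\to\mathcal{G}$ one has $\psi[k]\circ i_{\mathcal{F}}(a)=i_{\mathcal{G}}(a)\circ\psi$; (ii) $t_{\mathcal{F}}$ is a morphism of graded vector spaces with $t_{\mathcal{F}}(i_{\mathcal{F}}(a))=\mathrm{rank}(\mathcal{F})\,a$ for all $a\in\mathfrak{T}_{\mathcal{A}}^{\bullet}$. An object $\mathcal{F}$ is unitary with respect to $\mathfrak{T}_{\mathcal{A}}^{\bullet}$ if $\mathrm{Hom}^{\bullet}_{\mathcal{A}}(\mathcal{F},\mathcal{F})\simeq\mathfrak{T}_{\mathcal{A}}^{\bullet}$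 as graded rings. $\mathbb{C}\oplus\mathbb{C}[3]$ denotes the graded algebra with one copy of $\mathbb{C}$ in degree $0$ (spanned by the unit) and one in degree $3$, and zero elsewhere. Hodge numbers: for $\mathcal{A}$ smooth proper Calabi-Yau of dimension $3$ with a homological unit $\mathfrak{T}_{\mathcal{A}}^{\bullet}$, let $\mathrm{HH}_{\bullet}(\mathcal{A})$ be its Hochschild homology, graded so that $\mathrm{HH}^{\bullet}(\mathcal{A})\simeq\mathrm{HH}_{\bullet-3}(\mathcal{A})$, where $\mathrm{HH}^{\bullet}$ is Hochschild cohomology. Define: - $h^{i,0}(\mathcal{A})=\dim\mathfrak{T}_{\mathcal{A}}^{3-i}$ for $i=0,\ldots,3$; - $h^{3,1}(\mathcal{A})=\dim\mathrm{HH}_{-2}(\mathcal{A})-h^{2,0}(\mathcal{A})$; - $h^{3,2}(\mathcal{A})=h^{1,0}(\mathcal{A})$ and $h^{2,1}(\mathcal{A})=\dim\mathrm{HH}_{-1}(\mathcal{A})-h^{1,0}(\mathcal{A})-h^{3,2}(\mathcal{A})$; - $h^{3,3}(\mathcal{A})=h^{0,0}(\mathcal{A})$ and $h^{1,1}(\mathcal{A})=h^{2,2}(\mathcal{A})=\frac{1}{2}\left(\dim\mathrm{HH}_0(\mathcal{A})-h^{0,0}(\mathcal{A})-h^{3,3}(\mathcal{A})\right)$; - $h^{p,q}(\mathcal{A})=h^{q,p}(\mathcal{A})$ for all $p,q\in\{0,\ldots,3\}$. *)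

(* Defs.v *)
(* The definitions make sense over an arbitrary field [K]; the complex field is
   [R[i]] for [R : realType]. *)
From HB Require Import structures.
From mathcomp Require Import all_boot all_algebra ring_quotient.
From mathcomp Require Import boolp classical_sets fsbigop reals.
From mathcomp Require Import freeg complex.
Set Implicit Arguments.
Unset Strict Implicit.
Unset Printing Implicit Defensive.
Import GRing.Theory Num.Theory.
Local Open Scope ring_scope.

Section LinearMaps.
Variables (K : fieldType) (U V : lmodType K) (f : U -> V).
Hypothesis f_lin : linear f.

Fact lin_0 : f 0 = 0.
Proof. by have := f_lin (-1) 0 0; rewrite scaler0 addr0 scaleN1r addNr. Qed.
Fact lin_D x y : f (x + y) = f x + f y.
Proof. by have := f_lin 1 x y; rewrite !scale1r. Qed.
Fact lin_Z c x : f (c *: x) = c *: f x.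
Proof. by have := f_lin c x 0; rewrite lin_0 !addr0. Qed.

End LinearMaps.

Section Dimension.
Variables (K : fieldType) (V : lmodType K).
Implicit Types (Z W P : V -> Prop).

Definition lin_span P (x : V) : Prop :=
  exists n (c : 'I_n -> K) (v : 'I_n -> V),
    (forall i, P (v i)) /\ x = \sum_i c i *: v i.

(* The quotient [Z / (Z `&` W)] of two subspaces has dimension [n]. *)
Definition is_qdim Z W (n : nat) : Prop :=
  exists b : 'I_n -> V,
    [/\ forall i, Z (b i),
        forall c : 'I_n -> K, W (\sum_i c i *: b i) -> forall i, c i = 0
      & forall x, Z x -> exists c : 'I_n -> K, W (x - \sum_i c i *: b i)].

Definition fin_qdim Z W : Prop := exists n, is_qdim Z W n.

(* Junk value [0] for an infinite-dimensional quotient. *)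
Definition qdim Z W : nat := xget 0%N [set n | is_qdim Z W n]%classic.

Definition vdim : nat := qdim (fun=> True) (fun x => x = 0).

End Dimension.

Arguments vdim {K} V.

(* Graded objects are families indexed by [int].  A product
   [A k * A l -> A (k + l)] is indexed by a proof of [k + l = n], which makes
   associativity and similar laws expressible without transports. *)
Record grAlg (K : fieldType) := GrAlg {
  ga_gr :> int -> lmodType K;
  ga_one : ga_gr 0;
  ga_mul : forall k l n : int, k + l = n -> ga_gr k -> ga_gr l -> ga_gr n;
  ga_mul_linl : forall k l n (e : k + l = n) b, linear (fun a => ga_mul e a b);
  ga_mul_linr : forall k l n (e : k + l = n) a, linear (ga_mul e a);
  ga_mul1l : forall k (e : 0 + k = k) a, ga_mul e ga_one a = a;
  ga_mul1r : forall k (e : k + 0 = k) a, ga_mul e a ga_one = a;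
  ga_mulA : forall k l m kl lm n (e1 : k + l = kl) (e2 : kl + m = n)
    (e3 : l + m = lm) (e4 : k + lm = n) a b c,
    ga_mul e4 a (ga_mul e3 b c) = ga_mul e2 (ga_mul e1 a b) c }.

Section GradedAlgebras.
Variable K : fieldType.
Implicit Types S T : grAlg K.

Definition gr_multiplicative S T (f : forall k, S k -> T k) : Prop :=
  f 0 (ga_one S) = ga_one T /\
  forall k l n (e : k + l = n) a b,
    f n (ga_mul e a b) = ga_mul e (f k a) (f l b).

Definition gr_alg_morphism S T (f : forall k, {linear S k -> T k}) : Prop :=
  @gr_multiplicative S T (fun k => f k).

(* Isomorphism of graded rings: no [K]-linearity is required. *)
Definition gr_ring_iso S T : Prop :=
  exists f : forall k, {additive S k -> T k},
    @gr_multiplicative S T (fun k => f k) /\ forall k, bijective (f k).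

(* [K (+) K[d]]; for [d <> 0] the multiplication is forced by the unit laws and,
   on the square of the degree [d] part, by degree reasons. *)
Definition is_K_plus_shift (d : int) T : Prop :=
  [/\ ga_one T != 0,
      forall a : T 0, exists c : K, a = c *: ga_one T,
      exists2 x : T d, x != 0 & forall a : T d, exists c : K, a = c *: x
    & forall k, k <> 0 -> k <> d -> forall a : T k, a = 0].

End GradedAlgebras.

Record linCat (K : fieldType) := LinCat {
  lc_obj :> Type;
  hom : lc_obj -> lc_obj -> lmodType K;
  idm : forall X, hom X X;
  cmp : forall X Y Z, hom Y Z -> hom X Y -> hom X Z;
  cmp_linl : forall X Y Z (f : hom X Y), linear (fun g : hom Y Z => cmp g f);
  cmp_linr : forall X Y Z (g : hom Y Z), linear (@cmp X Y Z g);
  cmp1f : forall X Y (f : hom X Y), cmp (idm Y) f = f;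
  cmpf1 : forall X Y (f : hom X Y), cmp f (idm X) = f;
  cmpA : forall X Y Z W (h : hom Z W) (g : hom Y Z) (f : hom X Y),
    cmp h (cmp g f) = cmp (cmp h g) f }.

Arguments idm {K l} X.

Notation "g \c f" := (cmp g f) (at level 40, left associativity) : ring_scope.

Definition is_iso (K : fieldType) (C : linCat K) (X Y : C) (f : hom X Y) : Prop :=
  exists g : hom Y X, g \c f = idm X /\ f \c g = idm Y.

(* A coherent action of the group [int] by linear functors.  The structural
   isomorphisms are [X -> X[0]] and [X[k][l] -> X[n]] for [k + l = n]. *)
Record intShift (K : fieldType) (C : linCat K) := IntShift {
  sho : int -> C -> C;
  shm : forall k (X Y : C), hom X Y -> hom (sho k X) (sho k Y);
  shm_lin : forall k X Y, linear (@shm k X Y);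
  shm1 : forall k X, shm k (idm X) = idm (sho k X);
  shmM : forall k X Y Z (g : hom Y Z) (f : hom X Y),
    shm k (g \c f) = shm k g \c shm k f;
  sh0 : forall X, hom X (sho 0 X);
  sh0_iso : forall X, is_iso (sh0 X);
  sh0_nat : forall X Y (f : hom X Y), shm 0 f \c sh0 X = sh0 Y \c f;
  shD : forall k l n (e : k + l = n) X, hom (sho l (sho k X)) (sho n X);
  shD_iso : forall k l n (e : k + l = n) X, is_iso (shD e X);
  shD_nat : forall k l n (e : k + l = n) X Y (f : hom X Y),
    shm n f \c shD e X = shD e Y \c shm l (shm k f);
  shD0r : forall k (e : k + 0 = k) X, shD e X \c sh0 (sho k X) = idm (sho k X);
  shD0l : forall k (e : 0 + k = k) X, shD e X \c shm k (sh0 X) = idm (sho k X);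
  shDA : forall k l m kl lm n (e1 : k + l = kl) (e2 : kl + m = n)
    (e3 : l + m = lm) (e4 : k + lm = n) X,
    shD e2 X \c shm m (shD e1 X) = shD e4 X \c shD e3 (sho k X) }.

Record triCat (K : fieldType) := TriCat {
  tc_cat :> linCat K;
  tc_sh : intShift tc_cat;
  tc_zero : exists Z : tc_cat, idm Z = 0;
  tc_biprod : forall X Y : tc_cat, exists (S : tc_cat) (iX : hom X S) (iY : hom Y S)
    (pX : hom S X) (pY : hom S Y),
    [/\ pX \c iX = idm X, pY \c iY = idm Y, pX \c iY = 0, pY \c iX = 0
      & iX \c pX + iY \c pY = idm S];
  dist : forall X Y Z : tc_cat,
    hom X Y -> hom Y Z -> hom Z (sho tc_sh 1 X) -> Prop;
  tc_id : forall X Z : tc_cat, idm Z = 0 ->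
    dist (idm X) (0 : hom X Z) (0 : hom Z (sho tc_sh 1 X));
  tc_cone : forall (X Y : tc_cat) (u : hom X Y),
    exists Z (v : hom Y Z) (w : hom Z (sho tc_sh 1 X)), dist u v w;
  tc_isoclosed : forall (X Y Z X' Y' Z' : tc_cat)
    (u : hom X Y) (v : hom Y Z) (w : hom Z (sho tc_sh 1 X))
    (u' : hom X' Y') (v' : hom Y' Z') (w' : hom Z' (sho tc_sh 1 X'))
    (a : hom X X') (b : hom Y Y') (c : hom Z Z'),
    is_iso a -> is_iso b -> is_iso c ->
    u' \c a = b \c u -> v' \c b = c \c v -> w' \c c = shm tc_sh 1 a \c w ->
    dist u v w -> dist u' v' w';
  tc_rot : forall (X Y Z : tc_cat)
    (u : hom X Y) (v : hom Y Z) (w : hom Z (sho tc_sh 1 X)),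
    dist u v w <-> dist v w (- shm tc_sh 1 u);
  tc_fill : forall (X Y Z X' Y' Z' : tc_cat)
    (u : hom X Y) (v : hom Y Z) (w : hom Z (sho tc_sh 1 X))
    (u' : hom X' Y') (v' : hom Y' Z') (w' : hom Z' (sho tc_sh 1 X'))
    (a : hom X X') (b : hom Y Y'),
    dist u v w -> dist u' v' w' -> u' \c a = b \c u ->
    exists c : hom Z Z', v' \c b = c \c v /\ w' \c c = shm tc_sh 1 a \c w;
  tc_octa : forall (X Y Z X' Y' Z' : tc_cat) (u : hom X Y) (v : hom Y Z)
    (i : hom Y Z') (j : hom Z' (sho tc_sh 1 X))
    (k : hom Z X') (l : hom X' (sho tc_sh 1 Y))
    (m : hom Z Y') (n : hom Y' (sho tc_sh 1 X)),
    dist u i j -> dist v k l -> dist (v \c u) m n ->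
    exists (f : hom Z' Y') (g : hom Y' X'),
      [/\ f \c i = m \c v, n \c f = j, g \c m = k, l \c g = shm tc_sh 1 u \c n
        & dist f g (shm tc_sh 1 i \c l)] }.

Notation "X `[ k ]" := (sho (tc_sh _) k X)
  (at level 2, left associativity, format "X `[ k ]") : ring_scope.
Notation "f `<[ k ]>" := (shm (tc_sh _) k f)
  (at level 2, left associativity, format "f `<[ k ]>") : ring_scope.

Section EndAlgebra.
Variables (K : fieldType) (A : triCat K) (F : A).

Definition end_gr (k : int) : lmodType K := hom F F`[k].

(* [a * b = a[l] o b], followed by the identification [F[k][l] = F[k + l]]. *)
Definition end_mul k l n (e : k + l = n) (a : end_gr k) (b : end_gr l) : end_gr n :=
  shD (tc_sh A) e F \c (a`<[l]> \c b).

Fact end_mul_linl k l n (e : k + l = n) b : linear (fun a => end_mul e a b).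
Proof. by move=> c x y; rewrite /end_mul shm_lin cmp_linl cmp_linr. Qed.

Fact end_mul_linr k l n (e : k + l = n) a : linear (end_mul e a).
Proof. by move=> c x y; rewrite /end_mul !cmp_linr. Qed.

Fact end_mul1l k (e : 0 + k = k) a : end_mul e (sh0 (tc_sh A) F) a = a.
Proof. by rewrite /end_mul cmpA shD0l cmp1f. Qed.

Fact end_mul1r k (e : k + 0 = k) a : end_mul e a (sh0 (tc_sh A) F) = a.
Proof. by rewrite /end_mul sh0_nat cmpA shD0r cmp1f. Qed.

Fact end_mulA k l m kl lm n (e1 : k + l = kl) (e2 : kl + m = n)
    (e3 : l + m = lm) (e4 : k + lm = n) a b c :
  end_mul e4 a (end_mul e3 b c) = end_mul e2 (end_mul e1 a b) c.
Proof.
rewrite /end_mul !shmM !cmpA; congr (_ \c _ \c _).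
by rewrite (shDA _ e1 e2 e3 e4) -!cmpA shD_nat.
Qed.

(* The graded algebra [Hom^*(F, F)]. *)
Definition end_alg : grAlg K :=
  GrAlg end_mul_linl end_mul_linr end_mul1l end_mul1r end_mulA.

End EndAlgebra.

Section TriangulatedNotions.
Variables (K : fieldType) (A : triCat K).
Implicit Types (F G X Y Z : A) (rk : A -> int) (T : grAlg K).

(* [[p]] is a Serre functor: natural isomorphisms
   [Hom(X, Y) ~ Hom(Y, X[p])^*]. *)
Definition calabi_yau (p : int) : Prop :=
  exists s : forall X Y, hom X Y -> {scalar hom Y X`[p]},
    [/\ forall X Y (c : K) (f g : hom X Y) x,
          s X Y (c *: f + g) x = c * s X Y f x + s X Y g x,
        forall X Y (f : hom X Y), (forall x, s X Y f x = 0) -> f = 0,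
        forall X Y (phi : {scalar hom Y X`[p]}),
          exists f : hom X Y, forall x, s X Y f x = phi x,
        forall X Y Y' (g : hom Y Y') (f : hom X Y) (x : hom Y' X`[p]),
          s X Y' (g \c f) x = s X Y f (x \c g)
      & forall X' X Y (h : hom X' X) (f : hom X Y) (x : hom Y X'`[p]),
          s X' Y (f \c h) x = s X Y f (h`<[p]> \c x)].

Definition rank_function rk : Prop :=
  (forall X Y Z (u : hom X Y) (v : hom Y Z) (w : hom Z X`[1]),
     dist u v w -> rk Y = rk X + rk Z) /\
  (forall F, rk F`[1] = - rk F).

Definition nontrivial_rank rk : Prop := exists F, rk F != 0.

(* The sum is over the finite support, so it is meaningful only when
   [Hom^*(F, G)] is finite-dimensional. *)
Definition euler_form F G : int :=
  \sum_(k \in [set: int]%classic) (-1) ^ k * (vdim (hom F G`[k]))%:Z.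

Definition free_obj : zmodType := {freeg {classic A} / int}.
Definition fclass F : free_obj := << (F : {classic A}) >>.

Inductive K0_span : free_obj -> Prop :=
| K0_tri X Y Z (u : hom X Y) (v : hom Y Z) (w : hom Z X`[1]) :
    dist u v w -> K0_span (fclass Y - fclass X - fclass Z)
| K0_span0 : K0_span 0
| K0_spanB x y : K0_span x -> K0_span y -> K0_span (x - y).

Definition K0_rel : {pred free_obj} := fun x => `[< K0_span x >].

Fact K0_rel_zmod : zmod_closed K0_rel.
Proof.
split; first exact: (introT (asboolP _) K0_span0).
move=> x y hx hy; apply: (introT (asboolP _)).
by apply: K0_spanB; [exact: (elimT (asboolP _) hx)|exact: (elimT (asboolP _) hy)].
Qed.
HB.instance Definition _ := GRing.isZmodClosed.Build _ K0_rel K0_rel_zmod.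

Definition K0 : zmodType := Quotient.quot K0_rel.
Definition to_K0 : free_obj -> K0 := \pi_(Quotient.quot K0_rel)%qT.
Definition cl F : K0 := to_K0 (fclass F).

(* [chi(z, G)] for a formal combination [z] of objects. *)
Definition euler_free (z : free_obj) G : int :=
  fglift (fun F : {classic A} => euler_form F G : int^o) z.

Fact euler_freeB x y G : euler_free (x - y) G = euler_free x G - euler_free y G.
Proof. exact: (@lift_is_additive int {classic A} int^o). Qed.

(* The kernel of the form induced by [chi] on [K0]: since [chi] is additive on
   triangles, the condition does not depend on the representative [z].  This is
   the left kernel; under Serre duality it equals the right one. *)
Definition chi_ker : {pred K0} :=
  fun x => `[< exists2 z, to_K0 z = x & forall G, euler_free z G = 0 >].

Fact chi_ker_zmod : zmod_closed chi_ker.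
Proof.
split=> [|x y hx hy].
  apply: (introT (asboolP _)); exists 0 => [|G]; last by rewrite -(subrr 0) euler_freeB subrr.
  exact: (raddf0 (\pi_(Quotient.quot K0_rel)%qT : {additive _ -> _})).
case: (elimT (asboolP _) hx) (elimT (asboolP _) hy) => a <- ha [b <- hb].
apply: (introT (asboolP _)); exists (a - b) => [|G].
  exact: (raddfB (\pi_(Quotient.quot K0_rel)%qT : {additive _ -> _})).
by rewrite euler_freeB ha hb subrr.
Qed.
HB.instance Definition _ := GRing.isZmodClosed.Build _ chi_ker chi_ker_zmod.

Definition Knum : zmodType := Quotient.quot chi_ker.
Definition cl_num F : Knum := \pi_(Quotient.quot chi_ker)%qT (cl F).

Definition numerical rk : Prop :=
  exists r : {additive Knum -> int}, forall F, r (cl_num F) = rk F.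

Definition unit_property rk T : Prop :=
  exists (i : forall F k, {linear T k -> end_alg F k})
         (t : forall F k, {linear end_alg F k -> T k}),
    [/\ forall F, gr_alg_morphism (i F),
        forall F G k (a : T k) (psi : hom F G),
          psi`<[k]> \c (i F k a : hom F F`[k]) = (i G k a : hom G G`[k]) \c psi
      & forall F k (a : T k), t F k (i F k a) = (rk F)%:~R *: a].

(* Maximality: an embedding into a graded algebra with the same property is
   onto. *)
Definition homological_unit rk T : Prop :=
  unit_property rk T /\
  forall (T' : grAlg K) (j : forall k, {linear T k -> T' k}),
    unit_property rk T' -> gr_alg_morphism j -> (forall k, injective (j k)) ->
    forall k (b : T' k), exists a, j k a = b.

Definition unitary T F : Prop := gr_ring_iso (end_alg F) T.

End TriangulatedNotions.

(* For an abelian group [G], [G (x) K] is the quotient of the space [K[G]] of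
   formal combinations of elements of [G] by the additivity relations; the
   images of [S] span it iff [S] and these relations span [K[G]]. *)
Definition generates_tensor (K : fieldType) (G : zmodType) (S : G -> Prop) : Prop :=
  forall x : {freeg G / K},
    lin_span (fun z : {freeg G / K} =>
      (exists2 g, S g & z = << g >>) \/
      (exists g h, z = << g + h >> - << g >> - << h >>)) x.

Section GroundAlgebra.
Variable K : fieldType.

(* [K] concentrated in degree [0]. *)
Definition gd_gr (n : int) : lmodType K := 'rV[K]_(n == 0).
Definition gd_val n (a : gd_gr n) : K := \sum_j a 0 j.
Definition gd_mul k l n (e : k + l = n) (a : gd_gr k) (b : gd_gr l) : gd_gr n :=
  const_mx (gd_val a * gd_val b).

Fact gd_val_lin n : linear_for *%R (@gd_val n).
Proof.
move=> c a b; rewrite /gd_val mulr_sumr -big_split.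
by apply: eq_bigr => j _; rewrite !mxE.
Qed.

Fact gd_val_const n c : gd_val (const_mx c : gd_gr n) = c *+ (n == 0).
Proof.
rewrite /gd_val (eq_bigr (fun=> c)) => [|j _]; last by rewrite mxE.
by rewrite sumr_const card_ord.
Qed.

Fact gd_val0 n (a : gd_gr n) : n <> 0 -> gd_val a = 0.
Proof.
by move=> /eqP/negPf n0; rewrite /gd_val /gd_gr n0 in a *; rewrite big_ord0.
Qed.

Fact gd_const_val n (a : gd_gr n) : const_mx (gd_val a) = a.
Proof.
rewrite /gd_val /gd_gr in a *; apply/rowP => j; rewrite mxE; move: a j.
by case: (n == 0) => [a j|a [j hj]]; [rewrite big_ord1 (ord1 j)|case: (notF hj)].
Qed.

Fact gd_mul_linl k l n (e : k + l = n) b : linear (fun a => gd_mul e a b).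
Proof. by move=> c x y; apply/rowP => j; rewrite !mxE gd_val_lin mulrDl mulrA. Qed.

Fact gd_mul_linr k l n (e : k + l = n) a : linear (gd_mul e a).
Proof.
by move=> c x y; apply/rowP => j; rewrite !mxE gd_val_lin mulrDr mulrCA.
Qed.

Fact gd_mul1l k (e : 0 + k = k) a : gd_mul e (const_mx 1) a = a.
Proof. by rewrite /gd_mul gd_val_const mulr1n mul1r gd_const_val. Qed.

Fact gd_mul1r k (e : k + 0 = k) a : gd_mul e a (const_mx 1) = a.
Proof. by rewrite /gd_mul gd_val_const mulr1n mulr1 gd_const_val. Qed.

Fact gd_mulA k l m kl lm n (e1 : k + l = kl) (e2 : kl + m = n)
    (e3 : l + m = lm) (e4 : k + lm = n) a b c :
  gd_mul e4 a (gd_mul e3 b c) = gd_mul e2 (gd_mul e1 a b) c.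
Proof.
rewrite /gd_mul !gd_val_const; congr const_mx.
have [k0|/eqP k0] := eqVneq k 0; last by rewrite (gd_val0 a k0) !(mul0r, mul0rn).
have [l0|/eqP l0] := eqVneq l 0; last by rewrite (gd_val0 b l0) !(mul0r, mulr0, mul0rn).
have [m0|/eqP m0] := eqVneq m 0; last by rewrite (gd_val0 c m0) !(mul0r, mulr0, mul0rn).
have -> : (kl == 0) by rewrite -e1 k0 l0 addr0.
have -> : (lm == 0) by rewrite -e3 l0 m0 addr0.
by rewrite !mulr1n mulrA.
Qed.

Definition ground_alg : grAlg K :=
  GrAlg gd_mul_linl gd_mul_linr gd_mul1l gd_mul1r gd_mulA.

End GroundAlgebra.

(* Cohomological grading: differentials have degree [1]. *)
Record dgAlg (K : fieldType) := DgAlg {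
  da_alg :> grAlg K;
  da_d : forall m n : int, m + 1 = n -> da_alg m -> da_alg n;
  da_d_lin : forall m n (e : m + 1 = n), linear (da_d e);
  da_dd : forall l m n (e : l + 1 = m) (e' : m + 1 = n) a, da_d e' (da_d e a) = 0;
  da_leibniz : forall k l n k' l' n' (e : k + l = n) (ek : k + 1 = k')
    (el : l + 1 = l') (en : n + 1 = n') (e1 : k' + l = n') (e2 : k + l' = n') a b,
    da_d en (ga_mul e a b) =
      ga_mul e1 (da_d ek a) b + (-1) ^ k *: ga_mul e2 a (da_d el b) }.

Fact zero_leibniz (K : fieldType) (T : grAlg K) k l n k' l' n' (e : k + l = n) (ek : k + 1 = k')
    (el : l + 1 = l') (en : n + 1 = n') (e1 : k' + l = n') (e2 : k + l' = n')
    (a : T k) (b : T l) :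
  (0 : T n') = ga_mul e1 0 b + (-1) ^ k *: ga_mul e2 a (0 : T l').
Proof.
by rewrite (lin_0 (ga_mul_linr e2 a)) (lin_0 (ga_mul_linl e1 b)) scaler0 addr0.
Qed.

Fact zero_lin (K : fieldType) (U V : lmodType K) : linear (fun _ : U => 0 : V).
Proof. by move=> c x y; rewrite scaler0 addr0. Qed.

Definition groundDG (K : fieldType) : dgAlg K :=
  @DgAlg K (ground_alg K) (fun m n e a => 0) (fun m n e => @zero_lin K _ _)
    (fun l m n e e' a => erefl) (@zero_leibniz K (ground_alg K)).

(* DG [A]-[B]-bimodules, [K] acting centrally. *)
Record dgBimod (K : fieldType) (A B : dgAlg K) := DgBimod {
  bm :> int -> lmodType K;
  bd : forall m n : int, m + 1 = n -> bm m -> bm n;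
  bl : forall k l n : int, k + l = n -> A k -> bm l -> bm n;
  br : forall k l n : int, k + l = n -> bm k -> B l -> bm n;
  bd_lin : forall m n (e : m + 1 = n), linear (bd e);
  bl_linl : forall k l n (e : k + l = n) x, linear (fun a => bl e a x);
  bl_linr : forall k l n (e : k + l = n) a, linear (bl e a);
  br_linl : forall k l n (e : k + l = n) b, linear (fun x => br e x b);
  br_linr : forall k l n (e : k + l = n) x, linear (br e x);
  bdd : forall l m n (e : l + 1 = m) (e' : m + 1 = n) x, bd e' (bd e x) = 0;
  bl1 : forall k (e : 0 + k = k) x, bl e (ga_one A) x = x;
  br1 : forall k (e : k + 0 = k) x, br e x (ga_one B) = x;
  blA : forall k l m kl lm n (e1 : k + l = kl) (e2 : kl + m = n)
    (e3 : l + m = lm) (e4 : k + lm = n) a b x,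
    bl e4 a (bl e3 b x) = bl e2 (ga_mul e1 a b) x;
  brA : forall k l m kl lm n (e1 : k + l = kl) (e2 : kl + m = n)
    (e3 : l + m = lm) (e4 : k + lm = n) x a b,
    br e4 x (ga_mul e3 a b) = br e2 (br e1 x a) b;
  blrA : forall k l m kl lm n (e1 : k + l = kl) (e2 : kl + m = n)
    (e3 : l + m = lm) (e4 : k + lm = n) a x b,
    bl e4 a (br e3 x b) = br e2 (bl e1 a x) b;
  bl_leibniz : forall k l n k' l' n' (e : k + l = n) (ek : k + 1 = k')
    (el : l + 1 = l') (en : n + 1 = n') (e1 : k' + l = n') (e2 : k + l' = n') a x,
    bd en (bl e a x) = bl e1 (da_d ek a) x + (-1) ^ k *: bl e2 a (bd el x);
  br_leibniz : forall k l n k' l' n' (e : k + l = n) (ek : k + 1 = k')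
    (el : l + 1 = l') (en : n + 1 = n') (e1 : k' + l = n') (e2 : k + l' = n') x b,
    bd en (br e x b) = br e1 (bd ek x) b + (-1) ^ k *: br e2 x (da_d el b) }.

(* A right DG [B]-module is a bimodule over [K] and [B]: the left action of [K] is
   forced to be the scaling. *)
Notation dgMod B := (dgBimod (groundDG _) B).

Definition diag_bimod (K : fieldType) (B : dgAlg K) : dgBimod B B :=
  @DgBimod K B B B (@da_d K B) (@ga_mul K B) (@ga_mul K B) (@da_d_lin K B)
    (@ga_mul_linl K B) (@ga_mul_linr K B) (@ga_mul_linl K B) (@ga_mul_linr K B)
    (@da_dd K B) (@ga_mul1l K B) (@ga_mul1r K B) (@ga_mulA K B) (@ga_mulA K B)
    (@ga_mulA K B) (@da_leibniz K B) (@da_leibniz K B).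

Section DgModules.
Variables (K : fieldType) (A B : dgAlg K).
Implicit Types L M N P : dgBimod A B.

(* Maps of graded bimodules of degree [0], not necessarily closed. *)
Definition gr_bilinear M N (f : forall n, M n -> N n) : Prop :=
  [/\ forall n, linear (f n),
      forall k l n (e : k + l = n) (a : A k) x, f n (bl e a x) = bl e a (f l x)
    & forall k l n (e : k + l = n) x (b : B l), f n (br e x b) = br e (f k x) b].

Record dgMor M N := DgMor {
  dm :> forall n, M n -> N n;
  dm_bilin : gr_bilinear dm;
  dm_d : forall m n (e : m + 1 = n) x, dm (bd e x) = bd e (dm x) }.

Fact dm_id_bilin M : gr_bilinear (fun n (x : M n) => x).
Proof. by split. Qed.
Definition dm_id M : dgMor M M := @DgMor M M _ (dm_id_bilin M) (fun m n e x => erefl).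

Fact dm_comp_bilin L M N (g : dgMor M N) (f : dgMor L M) :
  gr_bilinear (fun n (x : L n) => g n (f n x)).
Proof.
case: (dm_bilin g) (dm_bilin f) => g1 g2 g3 [f1 f2 f3].
split=> [n c x y|k l n e a x|k l n e x b]; first by rewrite f1 g1.
  by rewrite f2 g2.
by rewrite f3 g3.
Qed.
Fact dm_comp_d L M N (g : dgMor M N) (f : dgMor L M) m n (e : m + 1 = n) x :
  g n (f n (bd e x)) = bd e (g m (f m x)).
Proof. by rewrite !dm_d. Qed.
Definition dm_comp L M N (g : dgMor M N) (f : dgMor L M) : dgMor L N :=
  DgMor (dm_comp_bilin g f) (dm_comp_d g f).

Definition homotopic M N (f g : dgMor M N) : Prop :=
  exists h : forall m n, n + 1 = m -> M m -> N n,
    [/\ forall m n (e : n + 1 = m), linear (h m n e),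
        forall k l n l' n' (e : k + l = n) (el : l' + 1 = l) (en : n' + 1 = n)
          (e' : k + l' = n') (a : A k) x,
          h n n' en (bl e a x) = (-1) ^ k *: bl e' a (h l l' el x),
        forall k l n k' n' (e : k + l = n) (ek : k' + 1 = k) (en : n' + 1 = n)
          (e' : k' + l = n') x (b : B l),
          h n n' en (br e x b) = br e' (h k k' ek x) b
      & forall l n m (e : l + 1 = n) (e' : n + 1 = m) x,
          f n x - g n x = bd e (h n l e x) + h m n e' (bd e' x)].

Definition htpy_equivalence M N (f : dgMor M N) : Prop :=
  exists g : dgMor N M,
    homotopic (dm_comp g f) (dm_id M) /\ homotopic (dm_comp f g) (dm_id N).

Definition htpy_retract N M : Prop :=
  exists (s : dgMor N M) (r : dgMor M N), homotopic (dm_comp r s) (dm_id N).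

Definition cocycle M n (x : M n) : Prop := bd (erefl (n + 1)) x = 0.
Definition coboundary M n (x : M n) : Prop :=
  exists m (e : m + 1 = n) (y : M m), x = bd e y.

Definition acyclic M : Prop := forall n (x : M n), cocycle x -> coboundary x.

Definition quasi_iso M N (f : dgMor M N) : Prop :=
  forall n, (forall x : M n, cocycle x -> coboundary (f n x) -> coboundary x) /\
            (forall y : N n, cocycle y -> exists2 x : M n, cocycle x & coboundary (y - f n x)).

Fact dm_zero_bilin M N : gr_bilinear (fun n (x : M n) => 0 : N n).
Proof.
split=> [n c x y|k l n e a x|k l n e x b]; first by rewrite scaler0 addr0.
  by rewrite (lin_0 (bl_linr e a)).
by rewrite (lin_0 (br_linl e b)).
Qed.
Fact dm_zero_d M N m n (e : m + 1 = n) (x : M m) : (0 : N n) = bd e (0 : N m).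
Proof. by rewrite (lin_0 (bd_lin e)). Qed.
Definition dm_zero M N : dgMor M N := DgMor (dm_zero_bilin M N) (@dm_zero_d M N).

(* Homotopically projective (K-projective) bimodules. *)
Definition hproj P : Prop :=
  forall N (f : dgMor P N), acyclic N -> homotopic f (dm_zero P N).

(* [P] is freely generated by a closed element of degree [0], i.e. [P] is
   isomorphic to [A (x) B] with its usual differential. *)
Definition free_rank1 P : Prop :=
  exists2 e : P 0, cocycle e &
    forall M (x : M 0),
      (exists2 f : forall n, P n -> M n, gr_bilinear f & f 0 e = x) /\
      (forall f g : forall n, P n -> M n, gr_bilinear f -> gr_bilinear g ->
         f 0 e = x -> g 0 e = x -> forall n y, f n y = g n y).

End DgModules.

Section Shift.
Variables (K : fieldType) (A B : dgAlg K) (s : int) (M : dgBimod A B).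

Fact shiftl k l n : k + l = n -> k + (l + s) = n + s.
Proof. by move=> <-; rewrite addrA. Qed.
Fact shiftr k l n : k + l = n -> k + s + l = n + s.
Proof. by move=> <-; rewrite addrAC. Qed.

Definition shift_gr (n : int) : lmodType K := M (n + s).
Definition shift_d m n (e : m + 1 = n) (x : shift_gr m) : shift_gr n :=
  (-1) ^ s *: bd (shiftr e) x.
Definition shift_l k l n (e : k + l = n) (a : A k) (x : shift_gr l) : shift_gr n :=
  (-1) ^ (s * k) *: bl (shiftl e) a x.
Definition shift_r k l n (e : k + l = n) (x : shift_gr k) (b : B l) : shift_gr n :=
  br (shiftr e) x b.

Let signD (k l : int) : (-1 : K) ^ (k + l) = (-1) ^ k * (-1) ^ l.
Proof. by rewrite expfzDr // oppr_eq0 oner_neq0. Qed.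
Let signK (k : int) : (-1 : K) ^ k * (-1) ^ k = 1.
Proof. by rewrite -expfzMl mulrNN mulr1 exp1rz. Qed.

Fact shift_d_lin m n (e : m + 1 = n) : linear (shift_d e).
Proof. by move=> c x y; rewrite /shift_d bd_lin scalerDr !scalerA mulrC. Qed.
Fact shift_l_linl k l n (e : k + l = n) x : linear (fun a => shift_l e a x).
Proof. by move=> c a b; rewrite /shift_l bl_linl scalerDr !scalerA mulrC. Qed.
Fact shift_l_linr k l n (e : k + l = n) a : linear (shift_l e a).
Proof. by move=> c x y; rewrite /shift_l bl_linr scalerDr !scalerA mulrC. Qed.
Fact shift_r_linl k l n (e : k + l = n) b : linear (fun x => shift_r e x b).
Proof. by move=> c x y; rewrite /shift_r br_linl. Qed.
Fact shift_r_linr k l n (e : k + l = n) x : linear (shift_r e x).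
Proof. by move=> c a b; rewrite /shift_r br_linr. Qed.

Fact shift_dd l m n (e : l + 1 = m) (e' : m + 1 = n) x : shift_d e' (shift_d e x) = 0.
Proof. by rewrite /shift_d (lin_Z (bd_lin _)) bdd !scaler0. Qed.
Fact shift_l1 k (e : 0 + k = k) x : shift_l e (ga_one A) x = x.
Proof. by rewrite /shift_l mulr0 expr0z scale1r bl1. Qed.
Fact shift_r1 k (e : k + 0 = k) x : shift_r e x (ga_one B) = x.
Proof. exact: br1. Qed.
Fact shift_lA k l m kl lm n (e1 : k + l = kl) (e2 : kl + m = n)
    (e3 : l + m = lm) (e4 : k + lm = n) a b x :
  shift_l e4 a (shift_l e3 b x) = shift_l e2 (ga_mul e1 a b) x.
Proof.
rewrite /shift_l (lin_Z (bl_linr _ _)) scalerA -signD -mulrDr.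
by rewrite (blA e1 (shiftl e2) (shiftl e3)) e1.
Qed.
Fact shift_rA k l m kl lm n (e1 : k + l = kl) (e2 : kl + m = n)
    (e3 : l + m = lm) (e4 : k + lm = n) x a b :
  shift_r e4 x (ga_mul e3 a b) = shift_r e2 (shift_r e1 x a) b.
Proof. exact: brA. Qed.
Fact shift_lrA k l m kl lm n (e1 : k + l = kl) (e2 : kl + m = n)
    (e3 : l + m = lm) (e4 : k + lm = n) a x b :
  shift_l e4 a (shift_r e3 x b) = shift_r e2 (shift_l e1 a x) b.
Proof.
rewrite /shift_l /shift_r (lin_Z (br_linl _ _)).
by rewrite (blrA (shiftl e1) (shiftr e2)).
Qed.
Fact shift_l_leibniz k l n k' l' n' (e : k + l = n) (ek : k + 1 = k')
    (el : l + 1 = l') (en : n + 1 = n') (e1 : k' + l = n') (e2 : k + l' = n') a x :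
  shift_d en (shift_l e a x) =
    shift_l e1 (da_d ek a) x + (-1) ^ k *: shift_l e2 a (shift_d el x).
Proof.
rewrite /shift_d /shift_l (lin_Z (bd_lin _)) (lin_Z (bl_linr _ _)).
rewrite (bl_leibniz (shiftl e) ek (shiftr el) (shiftr en) (shiftl e1) (shiftl e2)).
have -> : (-1 : K) ^ (s * k') = (-1) ^ s * (-1) ^ (s * k).
  by rewrite -ek mulrDr mulr1 signD mulrC.
rewrite !scalerDr !scalerA; congr (_ + _ *: _).
by rewrite mulrC mulrA mulrAC -mulrA mulrCA mulrA.
Qed.
Fact shift_r_leibniz k l n k' l' n' (e : k + l = n) (ek : k + 1 = k')
    (el : l + 1 = l') (en : n + 1 = n') (e1 : k' + l = n') (e2 : k + l' = n') x b :
  shift_d en (shift_r e x b) =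
    shift_r e1 (shift_d ek x) b + (-1) ^ k *: shift_r e2 x (da_d el b).
Proof.
rewrite /shift_d /shift_r (lin_Z (br_linl _ _)).
rewrite (br_leibniz (shiftr e) (shiftr ek) el (shiftr en) (shiftr e1) (shiftr e2)).
by rewrite !scalerDr !scalerA signD mulrCA signK mulr1.
Qed.

(* [M[s]^n = M^(n + s)], with differential multiplied by [(-1)^s] and left action
   twisted by [(-1)^(s |a|)]. *)
Definition dg_shift : dgBimod A B :=
  DgBimod shift_d_lin shift_l_linl shift_l_linr shift_r_linl shift_r_linr
    shift_dd shift_l1 shift_r1 shift_lA shift_rA shift_lrA
    shift_l_leibniz shift_r_leibniz.

End Shift.

Section ShiftMorphism.
Variables (K : fieldType) (A B : dgAlg K) (s : int) (M N : dgBimod A B).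
Variable f : dgMor M N.

Fact shift_mor_bilin :
  gr_bilinear (fun n (x : dg_shift s M n) => f (n + s) x : dg_shift s N n).
Proof.
case: (dm_bilin f) => f1 f2 f3; split=> [n|k l n e a x|k l n e x b].
- exact: f1.
- by rewrite /= /shift_l (lin_Z (f1 _)) f2.
- by rewrite /= /shift_r f3.
Qed.
Fact shift_mor_d m n (e : m + 1 = n) (x : dg_shift s M m) :
  f (n + s) (bd e x) = bd e (f (m + s) x : dg_shift s N m).
Proof.
case: (dm_bilin f) => f1 _ _.
by rewrite /= /shift_d (lin_Z (f1 _)) dm_d.
Qed.
Definition dm_shift : dgMor (dg_shift s M) (dg_shift s N) :=
  DgMor shift_mor_bilin shift_mor_d.

End ShiftMorphism.

Section Cone.
Variables (K : fieldType) (A B : dgAlg K) (M N : dgBimod A B) (f : dgMor M N).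
Local Notation M1 := (dg_shift 1 M).

(* [f] as a map of degree [1] from [M[1]] to [N]. *)
Definition cone_f m n (e : m + 1 = n) (x : M1 m) : N n :=
  eq_rect (m + 1) (fun i => N i) (f (m + 1) x) n e.

Definition cone_gr (n : int) : lmodType K := (N n * M1 n)%type.
Definition cone_d m n (e : m + 1 = n) (x : cone_gr m) : cone_gr n :=
  (bd e x.1 + cone_f e x.2, bd e x.2).
Definition cone_l k l n (e : k + l = n) (a : A k) (x : cone_gr l) : cone_gr n :=
  (bl e a x.1, bl e a x.2).
Definition cone_r k l n (e : k + l = n) (x : cone_gr k) (b : B l) : cone_gr n :=
  (br e x.1 b, br e x.2 b).

Let f_lin n : linear (f n). Proof. by case: (dm_bilin f). Qed.

Let f_Z n c (x : M n) : f n (c *: x) = c *: f n x.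
Proof. exact: (lin_Z (@f_lin n)). Qed.

Fact cone_f_lin m n (e : m + 1 = n) : linear (cone_f e).
Proof. by case: n / e => c x y; rewrite /cone_f /= f_lin. Qed.
Fact cone_f_d m n n' (e : m + 1 = n) (e' : n + 1 = n') x :
  bd e' (cone_f e x) = - cone_f e' (bd e x).
Proof.
case: n / e e' => e'; case: n' / e'.
rewrite /cone_f /= -dm_d /shift_d f_Z expr1z scaleN1r opprK.
by congr (f _ (bd _ _)); exact: eq_irrelevance.
Qed.
Fact cone_f_l k l n l' n' (e : k + l = n) (el : l + 1 = l') (en : n + 1 = n')
    (e' : k + l' = n') a x :
  cone_f en (bl e a x) = (-1) ^ k *: bl e' a (cone_f el x).
Proof.
case: l' / el e' => e'; case: n' / en e' => e'.
rewrite /cone_f /= /shift_l mul1r f_Z.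
case: (dm_bilin f) => _ -> _; congr (_ *: bl _ _ _); exact: eq_irrelevance.
Qed.
Fact cone_f_r k l n k' n' (e : k + l = n) (ek : k + 1 = k') (en : n + 1 = n')
    (e' : k' + l = n') x b :
  cone_f en (br e x b) = br e' (cone_f ek x) b.
Proof.
case: k' / ek e' => e'; case: n' / en e' => e'.
rewrite /cone_f /= /shift_r.
case: (dm_bilin f) => _ _ ->; congr (br _ _ _); exact: eq_irrelevance.
Qed.

Fact cone_d_lin m n (e : m + 1 = n) : linear (cone_d e).
Proof.
move=> c [y x] [y' x']; rewrite /cone_d; congr pair => /=.
  by rewrite (bd_lin e) (cone_f_lin e) scalerDr addrACA.
exact: (bd_lin (d := M1) e).
Qed.
Fact cone_l_linl k l n (e : k + l = n) x : linear (fun a => cone_l e a x).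
Proof. by case: x => y x c a b; congr pair; [exact: (bl_linl (d := N) e y)|exact: (bl_linl (d := M1) e x)]. Qed.
Fact cone_l_linr k l n (e : k + l = n) a : linear (cone_l e a).
Proof. by move=> c [y x] [y' x']; congr pair; [exact: (bl_linr (d := N) e a)|exact: (bl_linr (d := M1) e a)]. Qed.
Fact cone_r_linl k l n (e : k + l = n) b : linear (fun x => cone_r e x b).
Proof. by move=> c [y x] [y' x']; congr pair; [exact: (br_linl (d := N) e b)|exact: (br_linl (d := M1) e b)]. Qed.
Fact cone_r_linr k l n (e : k + l = n) x : linear (cone_r e x).
Proof. by case: x => y x c a b; congr pair; [exact: (br_linr (d := N) e y)|exact: (br_linr (d := M1) e x)]. Qed.
Fact cone_dd l m n (e : l + 1 = m) (e' : m + 1 = n) x : cone_d e' (cone_d e x) = 0.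
Proof.
case: x => y x; rewrite /cone_d; congr pair; rewrite /fst /snd.
  by rewrite (lin_D (bd_lin _)) bdd add0r cone_f_d addNr.
exact: (bdd (d := M1) e e').
Qed.
Fact cone_l1 k (e : 0 + k = k) x : cone_l e (ga_one A) x = x.
Proof. by case: x => y x; congr pair; [exact: (bl1 (d := N))|exact: (bl1 (d := M1))]. Qed.
Fact cone_r1 k (e : k + 0 = k) x : cone_r e x (ga_one B) = x.
Proof. by case: x => y x; congr pair; [exact: (br1 (d := N))|exact: (br1 (d := M1))]. Qed.
Fact cone_lA k l m kl lm n (e1 : k + l = kl) (e2 : kl + m = n)
    (e3 : l + m = lm) (e4 : k + lm = n) a b x :
  cone_l e4 a (cone_l e3 b x) = cone_l e2 (ga_mul e1 a b) x.
Proof. by congr pair; [exact: (blA (d := N))|exact: (blA (d := M1))]. Qed.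
Fact cone_rA k l m kl lm n (e1 : k + l = kl) (e2 : kl + m = n)
    (e3 : l + m = lm) (e4 : k + lm = n) x a b :
  cone_r e4 x (ga_mul e3 a b) = cone_r e2 (cone_r e1 x a) b.
Proof. by congr pair; [exact: (brA (d := N))|exact: (brA (d := M1))]. Qed.
Fact cone_lrA k l m kl lm n (e1 : k + l = kl) (e2 : kl + m = n)
    (e3 : l + m = lm) (e4 : k + lm = n) a x b :
  cone_l e4 a (cone_r e3 x b) = cone_r e2 (cone_l e1 a x) b.
Proof. by congr pair; [exact: (blrA (d := N))|exact: (blrA (d := M1))]. Qed.
Fact cone_l_leibniz k l n k' l' n' (e : k + l = n) (ek : k + 1 = k')
    (el : l + 1 = l') (en : n + 1 = n') (e1 : k' + l = n') (e2 : k + l' = n') a x :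
  cone_d en (cone_l e a x) =
    cone_l e1 (da_d ek a) x + (-1) ^ k *: cone_l e2 a (cone_d el x).
Proof.
congr pair; last exact: (bl_leibniz (d := M1)).
rewrite /= (bl_leibniz (d := N) e ek el en e1 e2) (cone_f_l e el en e2).
by rewrite (lin_D (bl_linr _ _)) scalerDr addrA.
Qed.
Fact cone_r_leibniz k l n k' l' n' (e : k + l = n) (ek : k + 1 = k')
    (el : l + 1 = l') (en : n + 1 = n') (e1 : k' + l = n') (e2 : k + l' = n') x b :
  cone_d en (cone_r e x b) =
    cone_r e1 (cone_d ek x) b + (-1) ^ k *: cone_r e2 x (da_d el b).
Proof.
congr pair; last exact: (br_leibniz (d := M1)).
rewrite /= (br_leibniz (d := N) e ek el en e1 e2) (cone_f_r e ek en e1).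
by have /= -> := lin_D (br_linl e1 b); rewrite addrAC.
Qed.

(* [cone(f)^n = N^n (+) M^(n+1)], [d(y, x) = (dy + f x, - dx)]. *)
Definition dg_cone : dgBimod A B :=
  DgBimod cone_d_lin cone_l_linl cone_l_linr cone_r_linl cone_r_linr
    cone_dd cone_l1 cone_r1 cone_lA cone_rA cone_lrA
    cone_l_leibniz cone_r_leibniz.

Fact cone_in_bilin : gr_bilinear (fun n (y : N n) => (y, 0) : dg_cone n).
Proof.
split=> [n c x y|k l n e a x|k l n e x b].
- by congr pair; rewrite /= scaler0 addr0.
- by congr pair; exact: (esym (lin_0 (bl_linr (d := M1) e a))).
- by congr pair; exact: (esym (lin_0 (br_linl (d := M1) e b))).
Qed.
Fact cone_in_d m n (e : m + 1 = n) (y : N m) :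
  ((bd e y, 0) : dg_cone n) = bd e ((y, 0) : dg_cone m).
Proof.
congr pair; last exact: (esym (lin_0 (bd_lin (d := M1) e))).
by rewrite /= (lin_0 (cone_f_lin e)) addr0.
Qed.
Definition cone_in : dgMor N dg_cone := DgMor cone_in_bilin cone_in_d.

Fact cone_out_bilin : gr_bilinear (fun n (z : dg_cone n) => z.2 : M1 n).
Proof. by []. Qed.
Definition cone_out : dgMor dg_cone M1 :=
  @DgMor K A B dg_cone M1 _ cone_out_bilin (fun m n e x => erefl).

End Cone.

(* Objects of the smallest thick subcategory of the homotopy category of DG
   bimodules containing [A (x) B].  They are homotopically projective, and they
   represent the perfect objects of the derived category. *)
Inductive perf_cell (K : fieldType) (A B : dgAlg K) : dgBimod A B -> Prop :=
| perf_free P : free_rank1 P -> perf_cell P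
| perf_shift s M : perf_cell M -> perf_cell (dg_shift s M)
| perf_cone M N (f : dgMor M N) : perf_cell M -> perf_cell N -> perf_cell (dg_cone f)
| perf_retract M N : perf_cell M -> htpy_retract N M -> perf_cell N.

Section DgAlgebraNotions.
Variables (K : fieldType) (B : dgAlg K).

Definition dg_proper : Prop :=
  (forall n : int, fin_qdim (@cocycle _ _ _ (diag_bimod B) n)
                            (@coboundary _ _ _ (diag_bimod B) n)) /\
  exists N : nat, forall n : int, (N < `|n|)%N ->
    forall x : diag_bimod B n, cocycle x -> coboundary x.

(* [B] is a perfect DG [B]-[B]-bimodule. *)
Definition dg_smooth : Prop :=
  exists (Q : dgBimod B B) (q : dgMor Q (diag_bimod B)),
    perf_cell Q /\ quasi_iso q.

(* [[B, P]^n], spanned by the graded commutators; [P / [B, P]] is the tensor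
   product of [B] and [P] over [B^op (x) B]. *)
Definition commutators (P : dgBimod B B) n : P n -> Prop :=
  lin_span (fun z : P n =>
    exists k l (e : k + l = n) (e' : l + k = n) (b : B k) (x : P l),
      z = bl e b x - (-1) ^ (k * l) *: br e' x b).

(* [HH_j(B)] has dimension [n]; it is the degree [j] cohomology of [P / [B, P]]
   for [P -> B] a homotopically projective resolution by bimodules.  With this
   cohomological indexing [HH^i(B) ~ HH_(i-3)(B)] when [B] is Calabi-Yau of
   dimension [3]. *)
Definition is_HH_dim (j : int) (n : nat) : Prop :=
  exists (P : dgBimod B B) (q : dgMor P (diag_bimod B)),
    [/\ hproj P, quasi_iso q
      & is_qdim (fun x : P j => commutators (bd (erefl (j + 1)) x))
                (fun x : P j => exists m (e : m + 1 = j) (y : P m),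
                                  commutators (x - bd e y)) n].

Definition HH_dim (j : int) : nat := xget 0%N [set n | is_HH_dim j n]%classic.

Variable T : grAlg K.

(* [hodge_lower p q] for [q <= p]. *)
Definition hodge_lower (p q : nat) : rat :=
  let h0 (i : nat) : rat := (vdim (T (3 - i%:Z)))%:R in
  let hh (j : int) : rat := (HH_dim j)%:R in
  match p, q with
  | _, 0 => h0 p
  | 1, 1 | 2, 2 => (hh 0 - h0 0%N - h0 0%N) / 2
  | 2, 1 => hh (-1) - h0 1%N - h0 1%N
  | 3, 1 => hh (-2) - h0 2%N
  | 3, 2 => h0 1%N
  | 3, 3 => h0 0%N
  | _, _ => 0
  end.

Definition hodge (p q : 'I_4) : rat := hodge_lower (maxn p q) (minn p q).

End DgAlgebraNotions.

(* An exact equivalence from [A] to the derived category of perfect right DG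
   [B]-modules, the latter being realized as the homotopy category of
   [perf_cell] modules.  [en_cls] is the inverse of the functor on morphisms:
   it sends a closed morphism of degree [0] to the morphism of [A] that it
   represents. *)
Record dgEnhancement (K : fieldType) (A : triCat K) (B : dgAlg K) := DgEnhancement {
  en_obj :> A -> dgMod B;
  en_perf : forall X, perf_cell (en_obj X);
  en_cls : forall X Y, dgMor (en_obj X) (en_obj Y) -> hom X Y;
  en_lin : forall X Y c (f g h : dgMor (en_obj X) (en_obj Y)),
    (forall n x, h n x = c *: f n x + g n x) ->
    en_cls h = c *: en_cls f + en_cls g;
  en_id : forall X, en_cls (dm_id (en_obj X)) = idm X;
  en_comp : forall X Y Z (g : dgMor (en_obj Y) (en_obj Z)) (f : dgMor (en_obj X) (en_obj Y)),
    en_cls (dm_comp g f) = en_cls g \c en_cls f;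
  en_full : forall X Y (u : hom X Y), exists f, en_cls f = u;
  en_faithful : forall X Y (f g : dgMor (en_obj X) (en_obj Y)),
    en_cls f = en_cls g <-> homotopic f g;
  en_esssurj : forall M : dgMod B, perf_cell M ->
    exists (X : A) (f : dgMor (en_obj X) M), htpy_equivalence f;
  en_sh : forall X, dgMor (en_obj X`[1]) (dg_shift 1 (en_obj X));
  en_sh_equiv : forall X, htpy_equivalence (en_sh X);
  en_sh_nat : forall X Y (f : dgMor (en_obj X) (en_obj Y))
    (f1 : dgMor (en_obj X`[1]) (en_obj Y`[1])),
    en_cls f1 = (en_cls f)`<[1]> ->
    homotopic (dm_comp (en_sh Y) f1) (dm_comp (dm_shift 1 f) (en_sh X));
  en_dist : forall X Y Z (u : hom X Y) (v : hom Y Z) (w : hom Z X`[1]),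
    dist u v w ->
    exists (f : dgMor (en_obj X) (en_obj Y)) (t : dgMor (en_obj Z) (dg_cone f)),
      [/\ en_cls f = u, htpy_equivalence t,
          forall g, en_cls g = v -> homotopic (dm_comp t g) (cone_in f)
        & forall h, en_cls h = w ->
            homotopic (dm_comp (en_sh X) h) (dm_comp (cone_out f) t)] }.

Definition unitary_generates_K0 (K : fieldType) (A : triCat K) (T : grAlg K) : Prop :=
  generates_tensor K (fun g : K0 A => exists2 F, unitary T F & g = cl F).

Definition unitary_generates_Knum (K : fieldType) (A : triCat K) (T : grAlg K) : Prop :=
  generates_tensor K (fun g : Knum A => exists2 F, unitary T F & g = cl_num F).

(* Main.v *)
(* A Hodge number of [A] depends on [T] only through the dimensions of the [T^k], so
   these are compared.  If [F] is unitary for [T2] and [rk1 F != 0], then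
   [t o i = rk1 F] makes [i : T1 -> Hom^*(F, F)] injective, and [Hom^*(F, F)] is
   isomorphic to [T2], whence [dim T1^k <= dim T2^k].  Such an [F] exists as soon as
   the classes of [T2]-unitary objects generate, because [rk1] induces a nonzero
   functional on the Grothendieck group.  When only [T1] has enough unitary objects
   and [T1 = K (+) K[3]], the bound [dim T2^k <= dim T1^k] is sharp: [T2^0] contains
   [1], and [T2^3 ~ Hom^3(G, G)] is dual to [Hom(G, G)] for [G] unitary.

   Two points need care.  Serre duality makes each [Hom(X, Y)] the full algebraic
   dual of its own full dual, which forces it to be finite-dimensional.  And
   unitarity is an isomorphism of graded rings, not of algebras, so it must be shown
   to preserve dimensions; this rests on [T^0] being commutative, which follows from
   the functoriality of [i]. *)
From HB Require Import structures.
(* [freeg] comes first so that its [lift] does not hide that of [fintype]. *)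
From mathcomp Require Import freeg.
From mathcomp Require Import all_boot all_algebra ring_quotient.
From mathcomp Require Import boolp classical_sets reals complex.
Require Import Defs.
Set Implicit Arguments.
Unset Strict Implicit.
Unset Printing Implicit Defensive.
Import GRing.Theory Num.Theory.
Local Open Scope ring_scope.

Definition linear_of (K : fieldType) (U V : lmodType K) (f : U -> V) (f_lin : linear f) :
  {linear U -> V} := HB.pack f (GRing.isLinear.Build _ _ _ _ f f_lin).

Definition scalar_of (K : fieldType) (V : lmodType K) (f : V -> K)
  (f_lin : linear_for *%R f) : {scalar V} := HB.pack f (GRing.isLinear.Build _ _ _ _ f f_lin).

(** * Free families, bases and dimension *)

Section FreeFamilies.
Variable K : fieldType.
Implicit Types U V : lmodType K.

Definition free_fam V n (v : 'I_n -> V) : Prop :=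
  forall c : 'I_n -> K, \sum_i c i *: v i = 0 -> forall i, c i = 0.

Definition gen_fam V n (v : 'I_n -> V) : Prop :=
  forall x, exists c : 'I_n -> K, x = \sum_i c i *: v i.

(** A bound on free families, unlike a finite basis, passes at once to the source of an injective
    linear map. *)
Definition fin_dim V : Prop :=
  exists n, forall m (v : 'I_m -> V), free_fam v -> (m <= n)%N.

(** If [n < m], the matrix expressing [v] through [b] has a nonzero left kernel vector, which is a
    nontrivial relation among the [v i]. *)
Lemma free_le_gen V m n (v : 'I_m -> V) (b : 'I_n -> V) :
  free_fam v -> gen_fam b -> (m <= n)%N.
Proof.
move=> fv gb; have /choice[C CE] := fun i => gb (v i).
rewrite leqNgt; apply/negP => ltnm.
pose A : 'M[K]_(m, n) := \matrix_(i, j) C i j.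
have : kermx A != 0.
  rewrite -mxrank_eq0 mxrank_ker subn_eq0 -ltnNge.
  exact: leq_ltn_trans (rank_leq_col A) ltnm.
case/rowV0Pn => u /sub_kermxP uA /eqP; apply; apply/rowP => i.
rewrite mxE; apply: (fv (u 0)).
transitivity (\sum_j (\sum_i u 0 i * C i j) *: b j).
  rewrite (eq_bigr (fun i => \sum_j (u 0 i * C i j) *: b j)) => [|k _].
    by rewrite exchange_big; apply: eq_bigr => j _; rewrite scaler_suml.
  by rewrite {1}CE scaler_sumr; apply: eq_bigr => j _; rewrite scalerA.
apply: big1 => j _; have /rowP/(_ j) := uA; rewrite !mxE => uAj.
by rewrite -[X in X *: _]/(\sum_i _) (eq_bigr (fun i => u 0 i * A i j))
  ?uAj ?scale0r // => k _; rewrite mxE.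
Qed.

Lemma gen_fin_dim V n (b : 'I_n -> V) : gen_fam b -> fin_dim V.
Proof. by move=> gb; exists n => m v fv; exact: free_le_gen fv gb. Qed.

Lemma max_free_gen V n (b : 'I_n -> V) :
  free_fam b -> (forall v : 'I_n.+1 -> V, ~ free_fam v) -> gen_fam b.
Proof.
move=> fb maxb x.
pose v i := if unlift ord0 i is Some j then b j else x.
have /existsNP[c /not_implyP[c0 /existsNP[i ci]]] := maxb v.
have vE : c ord0 *: x + \sum_j c (lift ord0 j) *: b j = 0.
  apply: etrans c0; rewrite big_ord_recl /v unlift_none; congr (_ + _).
  by apply: eq_bigr => j _; rewrite liftK.
have [c00|c00] := eqVneq (c ord0) 0.
  case: ci; case: (unliftP ord0 i) => [j|] -> //.
  move: vE; rewrite c00 scale0r add0r => /fb; exact.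
exists (fun j => - (c ord0)^-1 * c (lift ord0 j)).
apply: (scalerI c00); rewrite scaler_sumr.
move/eqP: vE; rewrite addr_eq0 => /eqP ->; rewrite -sumrN; apply: eq_bigr => j _.
by rewrite scalerA mulrA mulrN divff // mulN1r scaleNr.
Qed.

Lemma is_qdim_free_gen V n :
  is_qdim (fun=> True) (fun x : V => x = 0) n <->
  exists b : 'I_n -> V, free_fam b /\ gen_fam b.
Proof.
split=> [[b [_ fb gb]]|[b [fb gb]]]; exists b; split=> // x.
  by have [c /eqP] := gb x I; rewrite subr_eq0 => /eqP; exists c.
by move=> _; have [c ->] := gb x; exists c; rewrite subrr.
Qed.

Lemma fin_dim_basis V :
  fin_dim V -> exists b : 'I_(vdim V) -> V, free_fam b /\ gen_fam b.
Proof.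
move=> [N maxN]; apply/is_qdim_free_gen.
(* [vdim] is an [xget] with default [0]; it is the true dimension as soon as some [n] qualifies. *)
have [n nP] : exists n, is_qdim (fun=> True) (fun x : V => x = 0) n; last first.
  apply: (@xgetPex _ 0%N [set n | is_qdim (fun=> True) (fun x : V => x = 0) n]%classic).
  by exists n.
pose P m := `[< exists v : 'I_m -> V, free_fam v >].
have P0 : exists m, P m.
  by exists 0%N; apply/asboolP; exists (fun=> 0) => c _ [].
have PN m : P m -> (m <= N)%N by move=> /asboolP[v]; exact: maxN.
case: (ex_maxnP P0 PN) => n /asboolP[b fb] maxn.
exists n; apply/is_qdim_free_gen; exists b; split=> //; apply: max_free_gen => // v fv.
by have := maxn n.+1; rewrite ltnn => /(_ (asboolT (ex_intro _ v fv))).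
Qed.

Lemma free_le_vdim V n (v : 'I_n -> V) :
  fin_dim V -> free_fam v -> (n <= vdim V)%N.
Proof. by move=> /fin_dim_basis[b [_ gb]] fv; exact: free_le_gen fv gb. Qed.

Lemma vdim_le_gen V n (b : 'I_n -> V) : gen_fam b -> (vdim V <= n)%N.
Proof.
move=> gb; have [v [fv _]] := fin_dim_basis (gen_fin_dim gb).
exact: free_le_gen fv gb.
Qed.

Lemma vdim_gt0 V (x : V) : fin_dim V -> x <> 0 -> (0 < vdim V)%N.
Proof.
move=> fV x0; apply: (@free_le_vdim _ 1 (fun=> x)) => // c.
rewrite big_ord1 => /eqP; rewrite scaler_eq0 => /orP[/eqP c0 i|/eqP//].
by rewrite ord1.
Qed.

Section Injection.
Variables (U V : lmodType K) (f : {linear U -> V}).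
Hypothesis f_inj : injective f.

Lemma inj_free n (v : 'I_n -> U) : free_fam v -> free_fam (f \o v).
Proof.
move=> fv c; rewrite (eq_bigr (fun i => f (c i *: v i))) => [|i _]; last first.
  by rewrite linearZ.
by rewrite -linear_sum -[RHS](linear0 f) => /f_inj; exact: fv.
Qed.

Lemma inj_fin_dim : fin_dim V -> fin_dim U.
Proof. by move=> [n maxn]; exists n => m v /inj_free; exact: maxn. Qed.

Lemma inj_vdim : fin_dim V -> (vdim U <= vdim V)%N.
Proof.
move=> fV; have [v [fv _]] := fin_dim_basis (inj_fin_dim fV).
exact: free_le_vdim fV (inj_free fv).
Qed.
End Injection.
End FreeFamilies.

(** * Linear spans *)

Section Spans.
Variables (K : fieldType) (V : lmodType K).
Implicit Type P : V -> Prop.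

Definition subspace P := P 0 /\ forall c x y, P x -> P y -> P (c *: x + y).

Lemma mem_span P x : P x -> lin_span P x.
Proof.
by move=> Px; exists 1%N, (fun=> 1), (fun=> x); rewrite big_ord1 scale1r.
Qed.

Lemma subspace_span P : subspace (lin_span P).
Proof.
split=> [|a x y [m [c [v [Pv ->]]]] [n [d [w [Pw ->]]]]].
  by exists 0%N, (fun=> 0), (fun=> 0); split=> [[]|]; rewrite ?big_ord0.
exists (m + n)%N,
  (fun i => match split i with inl j => a * c j | inr j => d j end),
  (fun i => match split i with inl j => v j | inr j => w j end).
split=> [i|]; first by case: (split i).
rewrite big_split_ord /= scaler_sumr; congr (_ + _); apply: eq_bigr => i _.
  by rewrite (unsplitK (inl i)) scalerA.
by rewrite (unsplitK (inr i)).
Qed.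

Lemma span_ind P Q x :
  subspace Q -> (forall y, P y -> Q y) -> lin_span P x -> Q x.
Proof.
move=> [Q0 QD] PQ [n [c [v [Pv ->]]]].
elim/big_rec: _ => [//|i y _ Qy]; apply: QD => //; exact: PQ.
Qed.

End Spans.

(** * Extension of linear functionals by Zorn's lemma *)

Section Functionals.
Variables (K : fieldType) (V : lmodType K).

(* A linear functional on a subspace is represented by its graph. *)
Definition functional_graph (H : V * K^o -> Prop) :=
  subspace H /\ forall c, H (0, c) -> c = 0.

Lemma functional_graph_uniq H x c d :
  functional_graph H -> H (x, c) -> H (x, d) -> c = d.
Proof.
move=> [[_ HD] H0] Hc Hd; apply/eqP; rewrite -subr_eq0; apply/eqP/H0.
have := HD (-1) _ _ Hd Hc; congr H; congr pair => /=; last by rewrite scaleN1r addrC.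
by rewrite scaleN1r addNr.
Qed.

(** The functional is extended by the value [0] at [v]; the coefficient [t] cancels the component
    along [v]. *)
Lemma functional_graph_adjoin H v :
  functional_graph H -> (forall c, ~ H (v, c)) ->
  functional_graph (fun p => exists t, H (p.1 + t *: v, p.2)).
Proof.
move=> [[H0 HD] HK] nHv; split=> [|c [t]].
  split=> [|a [x c] [y d] [s Hx] [t Hy]]; first by exists 0; rewrite scale0r addr0.
  exists (a * s + t); have := HD a _ _ Hx Hy; congr H; congr pair => /=.
  by rewrite scalerDr scalerA scalerDl addrACA.
rewrite /= add0r; have [->|t0] := eqVneq t 0; first by rewrite scale0r; exact: HK.
move=> Hv; case: (nHv (t^-1 * c)); have := HD t^-1 _ _ Hv H0; congr H; congr pair => /=.
  by rewrite addr0 scalerA mulVf // scale1r.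
by rewrite addr0.
Qed.

Lemma functional_extension G : functional_graph G ->
  exists f : {scalar V}, forall x c, G (x, c) -> f x = c.
Proof.
move=> gG; pose P (H : set (V * K^o)) := H = set0 \/ functional_graph H /\ (G `<=` H)%classic.
have [F FP totF|A [PA maxA]] := @Zorn_bigcup _ P.
  have [[X0 [FX0 X0n]]|] := pselect (exists X, F X /\ X <> set0); last first.
    move=> nF; left; apply/seteqP; split=> // p [X FX Xp]; apply: nF; exists X; split=> //.
    by move=> X0; rewrite X0 in Xp.
  have FG X p : F X -> X p -> functional_graph X /\ (G `<=` X)%classic.
    by move=> /FP[->|].
  have [p0 Xp0] : exists p, X0 p.
    by apply: contrapT => nX; apply: X0n; apply/seteqP; split=> // p Xp; apply: nX; exists p.
  have [[[X00 _] _] GX0] := FG _ _ FX0 Xp0.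
  right; split; last by move=> p /GX0; exists X0.
  split; last by move=> c [X FX Xc]; have [[_ H] _] := FG _ _ FX Xc; exact: H.
  split=> [|c p q [X FX Xp] [Y FY Yq]]; first by exists X0.
  have [[[_ XD] _] _] := FG _ _ FX Xp; have [[[_ YD] _] _] := FG _ _ FY Yq.
  case: (totF X Y FX FY) => [XY|YX]; first by exists Y => //; apply: YD => //; exact: XY.
  by exists X => //; apply: XD => //; exact: YX.
have [gA GA] : functional_graph A /\ (G `<=` A)%classic.
  case: PA => [A0|]; last by [].
  case: (maxA G); last by right; split.
  by rewrite A0; split=> // /(_ 0); apply; case: gG => -[].
have /choice[f fP] : forall x, exists c, A (x, c).
  move=> v; apply: contrapT => nAv.
  have nA c : ~ A (v, c) by move=> Ac; apply: nAv; exists c.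
  case: (maxA (fun p => exists t, A (p.1 + t *: v, p.2))).
    split=> [[x c] Ap|/(_ (v, 0))]; first by exists 0; rewrite scale0r addr0.
    case: gA => -[A0 _] _ sub; apply: (nA 0); apply: sub.
    by exists (-1); rewrite scaleN1r subrr.
  right; split; first exact: functional_graph_adjoin.
  by move=> [x c] /GA Axc; exists 0; rewrite scale0r addr0.
have f_lin : linear_for *%R f.
  move=> c x y; apply: (functional_graph_uniq gA (fP _)).
  by case: gA => -[_ AD] _; exact: (AD c (x, f x) (y, f y)).
exists (scalar_of f_lin) => x c /GA Axc.
exact: (functional_graph_uniq gA (fP x)).
Qed.

Lemma separating_functional P x : subspace P -> ~ P x ->
  exists f : {scalar V}, f x = 1 /\ forall y, P y -> f y = 0.
Proof.
(* [G] is the graph, over [P + K x], of the functional that kills [P] and is [1] at [x]. *)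
move=> [P0 PD] nPx; pose G (p : V * K^o) := P (p.1 - (p.2 : K) *: x).
have [|f fG] := @functional_extension G.
  split=> [|c].
    split=> [|c [y a] [z b]]; first by rewrite /G scale0r subr0.
    move=> Gy Gz; have := PD c _ _ Gy Gz; congr P => /=.
    by rewrite scalerBr scalerDl scalerA opprD addrACA.
  rewrite /G /= sub0r; have [//|c0] := eqVneq c 0; move=> Pc; case: nPx.
  have := PD (- c^-1) _ _ Pc P0; congr P.
  by rewrite addr0 scaleNr scalerN opprK scalerA mulVf // scale1r.
exists f; split=> [|y Py]; apply: fG; first by rewrite /G /= scale1r subrr.
by rewrite /G /= scale0r subr0.
Qed.

End Functionals.

(** * A space in duality with its full dual is finite-dimensional *)

Section Reflexivity.
Variables (K : fieldType) (V W : lmodType K) (beta : V -> {scalar W}).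
Hypothesis beta_lin : forall w, linear_for *%R (beta^~ w).
Hypothesis beta_ontoW : forall phi : {scalar W}, exists v, forall w, beta v w = phi w.
Hypothesis beta_ontoV : forall phi : {scalar V}, exists w, forall v, beta v w = phi v.

(** A partial pair of dual bases, indexed by itself so that Zorn's lemma applies to inclusion. *)
Definition biorthogonal (S : set (V * W)) :=
  forall p q, S p -> S q -> beta p.1 q.2 = (`[< p = q >])%:R.

Lemma exists_max_biorthogonal : exists S, biorthogonal S /\
  forall S', (S `<` S')%classic -> ~ biorthogonal S'.
Proof.
apply: Zorn_bigcup => F FP totF p q [X FX Xp] [Y FY Yq].
case: (totF X Y FX FY) => [XY|YX]; first by apply: (FP Y) => //; exact: XY.
by apply: (FP X) => //; exact: YX.
Qed.

Let beta0l w : beta 0 w = 0.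
Proof. by have := beta_lin w (-1) 0 0; rewrite scaler0 addr0 mulN1r addNr. Qed.

Lemma beta_suml n (c : 'I_n -> K) v w :
  beta (\sum_i c i *: v i) w = \sum_i c i * beta (v i) w.
Proof.
elim/big_rec2: _ => [|i y x _ <-]; [exact: beta0l|exact: beta_lin].
Qed.

(** The values at the [(p i).2] are corrected one at a time by multiples of the [(p i).1], which are
    invisible to any [w] orthogonal to all first components. As [g] depends on the pair and not on
    its index, repetitions among the [p i] are harmless. *)
Lemma biorthogonal_interpolation S (g : V * W -> K) x0 n (p : 'I_n -> V * W) :
  biorthogonal S -> (forall i, S (p i)) ->
  exists x, (forall i, beta x (p i).2 = g (p i)) /\
    forall w, (forall q, S q -> beta q.1 w = 0) -> beta x w = beta x0 w.
Proof.
move=> bS; elim: n p => [|n IHn] p Sp; first by exists x0; split=> [[]|].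
have [x [xp xw]] := IHn (p \o lift ord0) (fun i => Sp _).
exists ((g (p ord0) - beta x (p ord0).2) *: (p ord0).1 + x); split=> [i|w Sw]; last first.
  by rewrite beta_lin Sw // mulr0 add0r; exact: xw.
rewrite beta_lin bS //; case: asboolP => [<-|p0i]; first by rewrite mulr1 subrK.
rewrite mulr0 add0r; case: (unliftP ord0 i) p0i => [j ->|->] // _; exact: xp.
Qed.

(** A vector [v] outside the span yields a [w] orthogonal to all first components, then a [v']
    orthogonal to all second components with [beta v' w = 1]; the pair [(v', w)] could be added to
    [S]. *)
Lemma max_biorthogonal_span S v : biorthogonal S ->
  (forall S', (S `<` S')%classic -> ~ biorthogonal S') ->
  lin_span (fun v => exists w, S (v, w)) v.
Proof.
move=> bS maxS; apply: contrapT => nv.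
have [f [fv fS]] := separating_functional (subspace_span _) nv.
have [w fw] := beta_ontoV f.
have Sw p : S p -> beta p.1 w = 0.
  by case: p => x y Sp; rewrite fw; apply/fS/mem_span; exists y.
(* Otherwise modify [v] into an [x] that kills the second components involved in [w] but has the
   same pairing with [w]: this pairing would be both [0] and [1]. *)
have nw : ~ lin_span (fun w => exists v, S (v, w)) w.
  move=> [n [c [b [Sb wE]]]]; have /choice[a aS] := Sb.
  have [x [xb xw]] := biorthogonal_interpolation (fun=> 0) v bS aS.
  have := xw _ Sw; rewrite [RHS]fw fv wE linear_sum big1 => [/eqP|i _].
    by rewrite eq_sym oner_eq0.
  by rewrite linearZ; have /= -> := xb i; rewrite mulr0.
have [g [gw gS]] := separating_functional (subspace_span _) nw.
have [v' gv'] := beta_ontoW g.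
have v'S p : S p -> beta v' p.2 = 0.
  by case: p => x y Sp; rewrite gv'; apply/gS/mem_span; exists x.
apply: (maxS (S `|` [set (v', w)])%classic).
  split=> [p Sp|]; first by left.
  move=> /(_ (v', w)) SvW; have := Sw _ (SvW (or_intror erefl)).
  by rewrite /= gv' gw => /eqP; rewrite oner_eq0.
move=> p q [Sp|->] [Sq|->] /=; first exact: bS.
- rewrite Sw //; case: asboolP => // pE; have := Sw _ Sp.
  by rewrite pE /= gv' gw.
- rewrite v'S //; case: asboolP => // qE; have := Sw _ Sq.
  by rewrite -qE /= gv' gw => /eqP; rewrite oner_eq0.
- by rewrite gv' gw asboolT.
Qed.

(** An infinite biorthogonal set would force a vector of [V] with infinitely many nonzero
    coordinates, although the first components span [V]. *)
Lemma reflexive_fin_dim : fin_dim V.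
Proof.
have [S [bS maxS]] := exists_max_biorthogonal.
have spanS v := max_biorthogonal_span v bS maxS.
(* [v] pairs to [1] with every second component of [S], so writing [v] as a
   finite combination of first components bounds the size of [S]. *)
have [v vP] : exists v, forall p, S p -> beta v p.2 = 1.
  pose G := lin_span (fun q : W * K^o => exists2 p, S p & q = (p.2, 1)).
  have [|f fG] := @functional_extension _ _ G; last first.
    have [v fv] := beta_ontoW f; exists v => p Sp; rewrite fv; apply: fG.
    by apply: mem_span; exists p.
  split=> [|c [n [a [b [bG E]]]]]; first exact: subspace_span.
  have /choice[p pP] : forall i, exists p, S p /\ b i = (p.2, 1).
    by move=> i; have [p Sp ->] := bG i; exists p.
  (* [x] pairs to [1] with each [(p i).2], so the sum of the [a i] is the pairing of [x] with the
     zero vector: the graph is single-valued. *)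
  have [x [xp _]] := biorthogonal_interpolation (fun=> 1) 0 bS (fun i => (pP i).1).
  have E1 : \sum_i a i *: (p i).2 = 0.
    have /(congr1 fst) /= := E.
    rewrite (big_morph fst (id1 := 0) (op1 := +%R)) // => E1; apply: etrans (esym E1).
    by apply: eq_bigr => i _; rewrite (pP i).2.
  have /(congr1 snd) /= := E.
  rewrite (big_morph snd (id1 := 0) (op1 := +%R)) // => ->.
  have E2 : beta x (\sum_i a i *: (p i).2) = 0 by rewrite E1 linear0.
  apply: etrans E2; rewrite linear_sum.
  by apply: eq_bigr => i _; rewrite (pP i).2 [RHS]linearZ /= xp.
have [n [c [b [bS1 vE]]]] := spanS v.
apply: (@gen_fin_dim _ _ n b) => x.
have bP y : (exists w, S (y, w)) -> exists i, y = b i.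
  move=> [w Syw]; apply: contrapT => nb.
  have := vP _ Syw; rewrite vE beta_suml big1 => [/eqP|i _].
    by rewrite eq_sym oner_eq0.
  have [z Sz] := bS1 i; rewrite (bS _ _ Sz Syw) asboolF ?mulr0 // => -[bE _].
  by apply: nb; exists i.
apply: (@span_ind _ _ _ (fun x => exists a : 'I_n -> K, x = \sum_i a i *: b i) _ _ _ (spanS x)).
  split=> [|a y z [d ->] [e ->]].
    by exists (fun=> 0); rewrite big1 // => i _; rewrite scale0r.
  exists (fun i => a * d i + e i); rewrite scaler_sumr -big_split.
  by apply: eq_bigr => i _; rewrite scalerDl scalerA.
move=> y /bP[i ->]; exists (fun j => (j == i)%:R).
rewrite (bigD1 i) //= eqxx scale1r big1 ?addr0 // => j /negPf ->.
by rewrite scale0r.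
Qed.

End Reflexivity.

(** * Coordinates in row vectors and matrices of operators *)

Section Coordinates.
Variables (K : fieldType) (V : lmodType K).

Definition comb n (v : 'I_n -> V) (r : 'rV[K]_n) : V := \sum_i r 0 i *: v i.

Lemma comb_lin n (v : 'I_n -> V) : linear (comb v).
Proof.
move=> c x y; rewrite /comb scaler_sumr -big_split; apply: eq_bigr => i _.
by rewrite !mxE scalerDl scalerA.
Qed.
HB.instance Definition _ n (v : 'I_n -> V) :=
  GRing.isLinear.Build _ _ _ _ (comb v) (comb_lin v).

Lemma comb_delta n (v : 'I_n -> V) i : comb v (delta_mx 0 i) = v i.
Proof.
rewrite /comb (bigD1 i) //= mxE !eqxx scale1r big1 ?addr0 // => j /negPf ji.
by rewrite mxE ji andbF scale0r.
Qed.

Lemma comb_mulmx m n (v : 'I_n -> V) (P : 'M[K]_(m, n)) r :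
  comb v (r *m P) = \sum_i r 0 i *: comb v (row i P).
Proof.
rewrite mulmx_sum_row linear_sum; apply: eq_bigr => i _; exact: linearZ.
Qed.

Lemma free_comb n (v : 'I_n -> V) : free_fam v -> injective (comb v).
Proof.
move=> fv x y /eqP; rewrite -subr_eq0 -linearB => /eqP /(fv ((x - y) 0)) xy.
by apply/eqP; rewrite -subr_eq0; apply/eqP/rowP => i; rewrite xy mxE.
Qed.

Lemma operator_matrix n (v : 'I_n -> V) (phi : V -> V) : linear phi -> gen_fam v ->
  exists M : 'M[K]_n, forall r, phi (comb v r) = comb v (r *m M).
Proof.
move=> phi_lin gv.
have /choice[C CE] : forall i, exists c : 'I_n -> K, phi (v i) = \sum_j c j *: v j.
  by move=> i; exact: gv.
pose F := linear_of phi_lin.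
exists (\matrix_(i, j) C i j) => r.
rewrite comb_mulmx -[LHS]/(F (comb v r)) linear_sum; apply: eq_bigr => i _.
rewrite linearZ /=; congr (_ *: _); rewrite -[LHS]/(phi (v i)) CE.
by apply: eq_bigr => j _; rewrite !mxE.
Qed.

End Coordinates.

(** * Dimensions under isomorphisms of graded rings *)

Definition comm0 (K : fieldType) (S : grAlg K) : Prop :=
  forall (e : 0 + 0 = 0 :> int) (a b : S 0), ga_mul e a b = ga_mul e b a.

Section RingIsomorphisms.
Variable K : numClosedFieldType.
Implicit Types S T : grAlg K.

(** A basis of [S 0] acts on [S k] by finitely many commuting matrices, which are trigonalized
    together; linearity carries triangularity over to all of [S 0]. *)
Lemma triangular_action S k : comm0 S -> fin_dim (S 0) -> fin_dim (S k) ->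
  exists (b : 'I_(vdim (S k)) -> S k) (L : S 0 -> 'M[K]_(vdim (S k))),
    [/\ injective (comb b),
        forall a r, ga_mul (add0r k) a (comb b r) = comb b (r *m L a)
      & forall a, is_trig_mx (L a)].
Proof.
move=> S0C fS0 fSk; set n := vdim (S k).
have [c [_ gc]] := fin_dim_basis fS0; have [v [fv gv]] := fin_dim_basis fSk.
have v_inj := free_comb fv.
have /choice[M ME] : forall a, exists M : 'M[K]_n, forall r,
    ga_mul (add0r k) a (comb v r) = comb v (r *m M).
  by move=> a; apply: operator_matrix gv; exact: ga_mul_linr.
have M_uniq a N : (forall r, ga_mul (add0r k) a (comb v r) = comb v (r *m N)) -> M a = N.
  by move=> NE; apply/row_matrixP => i; apply: v_inj; rewrite !rowE -ME -NE.
have MC a b : comm_mx (M a) (M b).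
  have MM x y : M (ga_mul (addr0 0) x y) = M y *m M x.
    apply: M_uniq => r.
    by rewrite -(ga_mulA _ _ (add0r k) (add0r k)) !ME mulmxA.
  by rewrite /comm_mx -!MM S0C.
have [] := @cotrigonalization K n [seq M (c i) | i <- enum 'I_(vdim (S 0))].
  by move=> _ _ /mapP[i _ ->] /mapP[j _ ->].
move=> P /unitarymx_unit Pu /allP trigP.
pose L a := P *m M a *m invmx P.
exists (fun i => comb v (row i P)), L.
have bE r : comb (fun i => comb v (row i P)) r = comb v (r *m P).
  by rewrite comb_mulmx.
split=> [x y|a r|a].
- by rewrite !bE => /v_inj /(can_inj (mulmxK Pu)).
- by rewrite !bE ME /L !mulmxA mulmxKV.
have [d ->] := gc a.
have -> : L (\sum_i d i *: c i) = \sum_i d i *: L (c i).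
  have -> : \sum_i d i *: L (c i) = P *m (\sum_i d i *: M (c i)) *m invmx P.
    rewrite mulmx_sumr mulmx_suml; apply: eq_bigr => i _.
    by rewrite -scalemxAr -scalemxAl.
  congr (_ *m _ *m _); apply: M_uniq => r.
  pose F (x : S k) := linear_of (ga_mul_linl (add0r k) x).
  rewrite -[LHS]/(F (comb v r) _) linear_sum mulmx_sumr linear_sum.
  by apply: eq_bigr => i _; rewrite linearZ /= ME -scalemxAr linearZ.
apply/is_trig_mxP => i j ij; rewrite summxE big1 // => l _; rewrite mxE.
have /trigP : M (c l) \in [seq M (c i) | i <- enum 'I_(vdim (S 0))].
  by apply/mapP; exists l; rewrite ?mem_enum.
by rewrite /= /similar_to conjumx // => /is_trig_mxP -> //; rewrite mulr0.
Qed.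

(* [c *: y = (c *: 1) * y], and the ring isomorphism pulls the scalars [c *: 1]
   of [T] back to elements of [S 0] only; triangularity of their action makes the
   image of a basis of [S k] free all the same. *)
Lemma ring_iso_vdim_le S T k : gr_ring_iso S T -> comm0 S ->
  fin_dim (S 0) -> fin_dim (S k) -> fin_dim (T k) -> (vdim (S k) <= vdim (T k))%N.
Proof.
move=> [f [[f1 fM] f_bij]] SC fS0 fSk fTk.
have [b [L [b_inj LE L_trig]]] := triangular_action SC fS0 fSk.
set n := vdim (S k) in b L b_inj LE L_trig *.
have L_uniq a N : (forall r, ga_mul (add0r k) a (comb b r) = comb b (r *m N)) -> L a = N.
  by move=> NE; apply/row_matrixP => i; apply: b_inj; rewrite !rowE -LE -NE.
have L0 : L 0 = 0.
  by apply: L_uniq => r; rewrite mulmx0 linear0 (lin_0 (ga_mul_linl _ _)).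
have L1 : L (ga_one S) = 1%:M by apply: L_uniq => r; rewrite mulmx1 ga_mul1l.
have LM x y : L (ga_mul (addr0 0) x y) = L y *m L x.
  by apply: L_uniq => r; rewrite -(ga_mulA _ _ (add0r k) (add0r k)) !LE mulmxA.
have [g fK gK] := f_bij 0; have f_inj i := bij_inj (f_bij i).
apply: (@free_le_vdim _ _ _ (fun i => f k (b i))) => // c c0.
apply: contrapT => /existsNP[i0 /eqP ci0].
(* These elements turn the relation among the [f k (b i)] in [T k] into a relation among the [b i]
   with coefficients in [S 0]. *)
pose a i := g (c i *: ga_one T).
case: (arg_maxnP (P := fun i => c i != 0) (fun i : 'I_n => i : nat) ci0) => m cm maxm.
have ab0 : \sum_i ga_mul (add0r k) (a i) (b i) = 0.
  apply: (f_inj k); rewrite raddf0 raddf_sum -[RHS]c0; apply: eq_bigr => i _.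
  by rewrite fM gK (lin_Z (ga_mul_linl _ _)) ga_mul1l.
have Lsum j : \sum_i L (a i) i j = 0.
  have : comb b (\sum_i row i (L (a i))) = comb b 0.
    rewrite linear0 linear_sum -[RHS]ab0; apply: eq_bigr => i _.
    by have := LE (a i) (delta_mx 0 i); rewrite comb_delta -rowE.
  move=> /b_inj/rowP/(_ j); rewrite summxE mxE => E; rewrite -[RHS]E.
  by apply: eq_bigr => i _; rewrite mxE.
(* In column [m] of the relation the terms [i < m] vanish by lower triangularity and the terms
   [i > m] because [c i = 0]. *)
have Lmm : L (a m) m m = 0.
  have := Lsum m; rewrite (bigD1 m) //= big1 ?addr0 // => i im.
  have [ltim|leim] := ltnP i m; first exact: (is_trig_mxP (L_trig _)).
  have [ci|ci] := eqVneq (c i) 0.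
    have -> : a i = 0 by apply: (f_inj 0); rewrite gK ci scale0r raddf0.
    by rewrite L0 mxE.
  by case/eqP: im; apply/val_inj/eqP; rewrite eqn_leq leim andbT; exact: maxm.
(* [a m] is invertible with inverse [a'], so the triangular matrix [L (a m)] cannot have a zero on
   its diagonal. *)
pose a' := g ((c m)^-1 *: ga_one T).
have aa' : ga_mul (addr0 0) (a m) a' = ga_one S.
  apply: (f_inj 0); rewrite fM !gK f1 (lin_Z (ga_mul_linl _ _)).
  by rewrite (lin_Z (ga_mul_linr _ _)) ga_mul1l scalerA divff // scale1r.
have := LM (a m) a'; rewrite aa' L1 => /matrixP/(_ m m).
rewrite !mxE eqxx big1 => [/eqP|j _]; first by rewrite oner_eq0.
have [ltmj|] := ltnP m j; first by rewrite (is_trig_mxP (L_trig a')) // mul0r.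
rewrite leq_eqVlt => /orP[/eqP/val_inj ->|ltjm]; first by rewrite Lmm mulr0.
by rewrite (is_trig_mxP (L_trig (a m))) // mulr0.
Qed.

End RingIsomorphisms.

(** * Finite-dimensionality of morphism spaces *)

Section Shifts.
Variables (K : fieldType) (A : triCat K).

(** Shifting back by [- p] undoes the shift. The retraction moves a functional on [hom X Y] to the
    shifted objects, where Serre duality represents it. *)
Lemma shm_retraction p (X Y : A) :
  exists u : {linear hom X`[p] Y`[p] -> hom X Y}, forall f : hom X Y, u f`<[p]> = f.
Proof.
have e : p + - p = 0 by rewrite subrr.
have [sY [sYK _]] := sh0_iso (tc_sh A) Y.
have [dX [_ dXK]] := shD_iso (tc_sh A) e X.
pose u (g : hom X`[p] Y`[p]) : hom X Y :=
  (sY \c shD (tc_sh A) e Y) \c (g`<[- p]> \c (dX \c sh0 (tc_sh A) X)).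
have u_lin : linear u.
  by move=> c x y; rewrite /u shm_lin cmp_linl cmp_linr.
exists (linear_of u_lin) => f.
rewrite -[LHS]/(u f`<[p]>) /u !cmpA -(cmpA sY) -(shD_nat _ e f).
by rewrite -!cmpA (cmpA _ dX) dXK cmp1f sh0_nat cmpA sYK cmp1f.
Qed.

Lemma hom_fin_dim p (X Y : A) : calabi_yau A p -> fin_dim (hom X Y).
Proof.
move=> [s [s_lin s_inj s_onto s_natl s_natr]].
apply: (@reflexive_fin_dim _ _ _ (s X Y)) => [w c f g|phi|phi].
- exact: s_lin.
- exact: s_onto.
have [u uK] := shm_retraction p X Y.
pose psi g := phi (u g).
have psi_lin : linear_for *%R psi by move=> c x y; rewrite /psi !linearP.
have [w wE] := s_onto _ _ (scalar_of psi_lin).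
exists w => f; have := wE f`<[p]>; rewrite -[RHS]/(phi (u _)) uK => <-.
(* Symmetry of the Serre pairing: both sides equal [s Y Y (idm Y)] evaluated at [w] followed by the
   shift of [f]. *)
by rewrite -[in LHS](cmp1f f) s_natr -[in RHS](cmpf1 w) s_natl.
Qed.

End Shifts.

(** * Properties of homological units *)

Section HomologicalUnits.
Variables (K : numFieldType) (A : triCat K).
Implicit Types (rk : A -> int) (T : grAlg K).

Lemma unit_embedding rk T (F : A) : unit_property rk T -> rk F != 0 ->
  exists i : forall k, {linear T k -> end_alg F k},
    [/\ gr_alg_morphism i, forall k, injective (i k)
      & forall k (a : T k) (psi : hom F F),
          psi`<[k]> \c (i k a : hom F F`[k]) = (i k a : hom F F`[k]) \c psi].
Proof.
move=> [i [t [iM i_nat tiE]]] rF; exists (i F); split=> // k x y ixy.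
have rK : (rk F)%:~R != 0 :> K by rewrite intr_eq0.
by apply: (scalerI rK); rewrite -!tiE ixy.
Qed.

(** By functoriality [i 0 a] commutes with every endomorphism of [F], in particular with the one
    that [i 0 b] becomes under the isomorphism of [F] with its shift by [0]. *)
Lemma unit_comm0 rk T : unit_property rk T -> nontrivial_rank rk -> comm0 T.
Proof.
move=> Tu [F rF] e a b; have [i [[_ iM] i_inj i_nat]] := unit_embedding Tu rF.
apply: (i_inj 0); rewrite !iM /= /end_mul.
have [s [_ sK]] := sh0_iso (tc_sh A) F.
have bE : i 0 b = sh0 (tc_sh A) F \c (s \c i 0 b) by rewrite cmpA sK cmp1f.
move: (s \c _) bE => psi bE.
rewrite !bE.
rewrite (cmpA (i 0 a)`<[0]>) sh0_nat !cmpA shD0r cmp1f.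
by rewrite shmM !cmpA shD0l cmp1f i_nat.
Qed.

Lemma end_fin_dim p (F : A) k : calabi_yau A p -> fin_dim (end_alg F k).
Proof. exact: hom_fin_dim. Qed.

Lemma unit_fin_dim p rk T k : calabi_yau A p -> unit_property rk T ->
  nontrivial_rank rk -> fin_dim (T k).
Proof.
move=> CY Tu [F rF]; have [i [_ i_inj _]] := unit_embedding Tu rF.
exact: inj_fin_dim (i_inj k) (end_fin_dim F k CY).
Qed.

Lemma sh0_eq0 (F : A) : sh0 (tc_sh A) F = 0 -> idm F = 0.
Proof.
move=> s0; have [s [<- _]] := sh0_iso (tc_sh A) F.
by rewrite s0 (lin_0 (cmp_linr s)).
Qed.

(** For a zero object, [F -> F -> F] with first map the identity is a distinguished triangle, so
    [rk F = rk F + rk F]. *)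
Lemma rank0 rk (F : A) : rank_function rk -> idm F = 0 -> rk F = 0.
Proof.
move=> [rk_tri _] F0; have := rk_tri _ _ _ _ _ _ (tc_id F F0).
by rewrite -{1}[rk F]addr0 => /addrI.
Qed.

Lemma unit_one_neq0 rk T : unit_property rk T -> rank_function rk ->
  nontrivial_rank rk -> ga_one T <> 0.
Proof.
move=> Tu rkP [F rF] T0; have [i [[i1 _] _ _]] := unit_embedding Tu rF.
case/eqP: rF; apply: (rank0 rkP); apply: sh0_eq0.
by rewrite -[LHS]i1 T0 linear0.
Qed.

(** Serre duality turns the nonzero identity into a nonzero functional on degree [p]. *)
Lemma CY_top_neq0 p (F : A) : calabi_yau A p -> idm F <> 0 ->
  exists x : end_alg F p, x <> 0.
Proof.
move=> [s [_ s_inj _ _ _]] F0; apply: contrapT => nx; apply/F0/s_inj => x.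
have [->|x0] := pselect (x = 0); first by rewrite linear0.
by case: nx; exists x.
Qed.

End HomologicalUnits.

(** * Rank functions on Grothendieck groups *)

Section Generation.
Variable K : numFieldType.

Lemma fglift_lin (G : choiceType) (h : G -> K^o) : linear (fglift h).
Proof.
pose l := fglift h.
pose L : {additive {freeg G / K} -> K^o} :=
  HB.pack l (GRing.isZmodMorphism.Build _ _ l (lift_is_additive h)).
move=> c x y; rewrite -[LHS]/(L (c *: x + y)) -/l -[l y]/(L y) raddfD.
have -> : c *: x = \sum_(z <- dom x) << c * coeff z x *g z >> by [].
congr (_ + _); rewrite -[in RHS](freeg_sumE x) -[l (\sum_(z <- _) _)]/(L _).
rewrite !raddf_sum /= /l; apply: eq_bigr => g _.
by rewrite !liftU scalerA.
Qed.

(** If [r] vanished on [S], its linear extension to formal combinations would kill [S] and the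
    additivity relations, hence everything; in characteristic [0] this gives [r g = 0]. *)
Lemma generates_tensor_neq0 (G : zmodType) (S : G -> Prop) (r : {additive G -> int}) g :
  generates_tensor K S -> r g != 0 -> exists2 h, S h & r h != 0.
Proof.
move=> gS; apply: contraPP => nS; apply/negP; rewrite negbK -(intr_eq0 K).
pose l := linear_of (fglift_lin (fun h => (r h)%:~R : K^o)).
have lU h : l << h >> = (r h)%:~R by rewrite -[LHS]/(fglift _ _) liftU scale1r.
rewrite -lU; apply/eqP; apply: (@span_ind _ _ _ (fun x => l x = 0) _ _ _ (gS _)).
  split=> [|c x y x0 y0]; first exact: linear0.
  by rewrite linearP x0 y0 scaler0 addr0.
move=> _ [[h Sh ->]|[h [k ->]]].
  rewrite lU; have [->//|rh] := eqVneq (r h) 0.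
  by case: nS; exists h.
by rewrite !linearB !lU raddfD intrD -addrA -opprD subrr.
Qed.

Section RankOnK0.
Variables (A : triCat K) (rk : A -> int).
Hypothesis rkP : rank_function rk.

Let lift (z : free_obj A) : int := fglift (fun F : {classic A} => rk F : int^o) z.

Let liftB x y : lift (x - y) = lift x - lift y.
Proof. exact: (@lift_is_additive int {classic A} int^o). Qed.

Let liftU F : lift (fclass F) = rk F.
Proof. by rewrite /lift liftU scale1r. Qed.

(** The extension of [rk] to the free group kills the triangle relations, so its value does not
    depend on the representative chosen by [repr]. *)
Lemma rank_K0 : exists r : {additive K0 A -> int}, forall F, r (cl F) = rk F.
Proof.
have lift_span z : K0_span z -> lift z = 0.
  elim=> [X Y Z u v w uvw||x y _ x0 _ y0]; last by rewrite liftB x0 y0.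
    rewrite !liftB !liftU (rkP.1 _ _ _ _ _ _ uvw).
    by rewrite -addrA -opprD subrr.
  by have := liftB 0 0; rewrite !subrr.
have lift_pi x y : to_K0 x = to_K0 y -> lift x = lift y.
  move=> /eqP; rewrite -Quotient.idealrBE => /asboolP/lift_span/eqP.
  by rewrite liftB subr_eq0 => /eqP.
pose r (x : K0 A) := lift (repr x).
have r_add : zmod_morphism r.
  move=> x y; rewrite /r -liftB; apply: lift_pi.
  by rewrite /to_K0 raddfB /= !reprK.
pose r' : {additive K0 A -> int} := HB.pack r (GRing.isZmodMorphism.Build _ _ r r_add).
exists r' => F.
by rewrite -[RHS]liftU; apply: lift_pi; rewrite /to_K0 reprK.
Qed.

End RankOnK0.
End Generation.

(** * Comparison of two homological units *)

Section Comparison.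
Variables (K : numClosedFieldType) (A : triCat K) (p : int).
Hypothesis CY : calabi_yau A p.
Variables (rk1 rk2 : A -> int) (T1 T2 : grAlg K).
Hypotheses (rk1nt : nontrivial_rank rk1) (rk2nt : nontrivial_rank rk2).
Hypotheses (T1P : unit_property rk1 T1) (T2P : unit_property rk2 T2).

Lemma unitary_vdim_le (F : A) k : unitary T2 F -> rk1 F != 0 ->
  (vdim (T1 k) <= vdim (T2 k))%N.
Proof.
move=> uF rF; have [i [_ i_inj _]] := unit_embedding T1P rF.
apply: leq_trans (inj_vdim (i_inj k) (end_fin_dim F k CY)) _.
apply: (ring_iso_vdim_le uF); last exact: unit_fin_dim CY T2P rk2nt.
(* Commutativity in degree [0] is pulled back from [T2] along the ring isomorphism. *)
- move=> e a b; have [f [[_ fM] f_bij]] := uF.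
  by apply: (bij_inj (f_bij 0)); rewrite !fM (unit_comm0 T2P rk2nt).
- exact: end_fin_dim CY.
- exact: end_fin_dim CY.
Qed.

Lemma generates_K0_unitary : rank_function rk1 -> unitary_generates_K0 A T2 ->
  exists2 F, unitary T2 F & rk1 F != 0.
Proof.
move=> rk1P gen; have [r rE] := rank_K0 rk1P; have [F0 rF0] := rk1nt.
have [|_ [F uF ->] rF] := generates_tensor_neq0 (g := cl F0) gen (r := r).
  by rewrite rE.
by exists F; rewrite -?rE.
Qed.

Lemma generates_Knum_unitary : numerical rk1 -> unitary_generates_Knum A T2 ->
  exists2 F, unitary T2 F & rk1 F != 0.
Proof.
move=> [r rE] gen; have [F0 rF0] := rk1nt.
have [|_ [F uF ->] rF] := generates_tensor_neq0 (g := cl_num F0) gen (r := r).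
  by rewrite rE.
by exists F; rewrite -?rE.
Qed.

(* Degree [0] of [T1] contains [1], and degree [p] contains the Serre dual of the
   identity of [G]. *)
Lemma K_plus_shift_vdim k (F G : A) : p != 0 -> rank_function rk1 ->
  is_K_plus_shift p T2 -> unitary T2 F -> rk1 F != 0 -> unitary T1 G ->
  vdim (T1 k) = vdim (T2 k).
Proof.
move=> p0 rk1P [_ T20 [x _ T2p] T2k] uF rF uG.
have := unitary_vdim_le k uF rF => le12.
have fT1 := unit_fin_dim k CY T1P rk1nt.
have one0 := unit_one_neq0 T1P rk1P rk1nt.
have gen1 l (y : T2 l) : (forall a, exists c, a = c *: y) -> (vdim (T2 l) <= 1)%N.
  move=> yP; apply: (@vdim_le_gen _ _ 1 (fun=> y)) => z; have [c ->] := yP z.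
  by exists (fun=> c); rewrite big_ord1.
have [k0|k0] := eqVneq k 0.
  subst k; apply/eqP; rewrite eqn_leq le12 (leq_trans (gen1 _ _ T20)) //.
  exact: vdim_gt0 one0.
have [kp|kp] := eqVneq k p; last first.
  apply/eqP; rewrite eqn_leq le12 (leq_trans _ (leq0n _)) //.
  apply: (@vdim_le_gen _ _ 0 (fun=> 0)) => z; exists (fun=> 0).
  by rewrite big_ord0; apply: T2k; apply/eqP.
subst k; apply/eqP; rewrite eqn_leq le12 (leq_trans (gen1 _ _ T2p)) //.
have [f [[f1 _] f_bij]] := uG.
have [|y y0] := CY_top_neq0 (F := G) CY.
  (* If [G] were a zero object, the unit of its endomorphism algebra, and with it the unit of [T1],
     would vanish. *)
  move=> G0; apply: one0; rewrite -f1.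
  have -> : ga_one (end_alg G) = 0; last exact: raddf0.
  by rewrite -[LHS]/(sh0 _ _) -[LHS]cmpf1 G0 (lin_0 (cmp_linr _)).
apply: (@vdim_gt0 _ _ (f p y)) => // fy; apply: y0.
by apply: (bij_inj (f_bij p)); rewrite fy raddf0.
Qed.

End Comparison.

(** * Equality of the Hodge numbers *)

Lemma eq_hodge (K : fieldType) (B : dgAlg K) (T1 T2 : grAlg K) :
  (forall k, vdim (T1 k) = vdim (T2 k)) ->
  forall p q, hodge B T1 p q = hodge B T2 p q.
Proof. by move=> E p q; rewrite /hodge /hodge_lower !E. Qed.

Theorem theorem3p1p3 (R : realType) (A : triCat R[i]) (B : dgAlg R[i])
    (enhA : dgEnhancement A B) (properB : dg_proper B) (smoothB : dg_smooth B)
    (CY3 : calabi_yau A 3) (rk1 rk2 : A -> int)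
    (rk1P : rank_function rk1) (rk2P : rank_function rk2)
    (rk1nt : nontrivial_rank rk1) (rk2nt : nontrivial_rank rk2)
    (T1 T2 : grAlg R[i])
    (T1P : homological_unit rk1 T1) (T2P : homological_unit rk2 T2) :
  ((unitary_generates_K0 A T1 -> unitary_generates_K0 A T2 ->
      forall p q : 'I_4, hodge B T1 p q = hodge B T2 p q) /\
   (is_K_plus_shift 3 T1 -> unitary_generates_K0 A T1 ->
      (exists F : A, unitary T2 F) ->
      forall p q : 'I_4, hodge B T1 p q = hodge B T2 p q)) /\
  (numerical rk1 -> numerical rk2 ->
    (unitary_generates_Knum A T1 -> unitary_generates_Knum A T2 ->
      forall p q : 'I_4, hodge B T1 p q = hodge B T2 p q) /\
    (is_K_plus_shift 3 T1 -> unitary_generates_Knum A T1 ->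
      (exists F : A, unitary T2 F) ->
      forall p q : 'I_4, hodge B T1 p q = hodge B T2 p q)).
Proof.
case: T1P T2P => [u1 _] [u2 _].
(* [two] serves both versions of (a) and [one] both versions of (b); the versions differ only in how
   unitary objects of nonzero rank are found. *)
have two F1 F2 : unitary T1 F1 -> rk2 F1 != 0 -> unitary T2 F2 -> rk1 F2 != 0 ->
    forall p q : 'I_4, hodge B T1 p q = hodge B T2 p q.
  move=> uF1 rF1 uF2 rF2; apply: eq_hodge => k; apply/eqP; rewrite eqn_leq.
  by rewrite (unitary_vdim_le CY3 rk2nt u1 u2 k uF2) ?(unitary_vdim_le CY3 rk1nt u2 u1 k uF1).
have one F1 : is_K_plus_shift 3 T1 -> unitary T1 F1 -> rk2 F1 != 0 ->
    (exists F : A, unitary T2 F) -> forall p q : 'I_4, hodge B T1 p q = hodge B T2 p q.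
  move=> T1S uF1 rF1 [F2 uF2]; apply: eq_hodge => k.
  (* Here [T1] is the algebra with two one-dimensional pieces, so the units enter in exchanged
     order. *)
  exact/esym/(K_plus_shift_vdim CY3 rk2nt rk1nt u2 u1 k _ rk2P T1S uF1 rF1 uF2).
split; [split|move=> num1 num2; split].
- move=> g1 g2; have [F1 uF1 rF1] := generates_K0_unitary rk2nt rk2P g1.
  by have [F2 uF2 rF2] := generates_K0_unitary rk1nt rk1P g2; exact: two rF1 _ rF2.
- by move=> T1S /(generates_K0_unitary rk2nt rk2P)[F1 uF1 rF1]; exact: one rF1.
- move=> g1 g2; have [F1 uF1 rF1] := generates_Knum_unitary rk2nt num2 g1.
  by have [F2 uF2 rF2] := generates_Knum_unitary rk1nt num1 g2; exact: two rF1 _ rF2.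
- by move=> T1S /(generates_Knum_unitary rk2nt num2)[F1 uF1 rF1]; exact: one rF1.
Qed.
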